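(* Let $\mathfrak g$ be a finite-dimensional complex simple Lie algebra, let $\mathfrak L(\mathfrak g)$ be the associated affine-Virasoro Lie algebra, and let $\widetilde{\mathfrak g}=(\mathfrak g\otimes\mathbb C[t^{\pm1}])\oplus\mathbb C K_1$, an ideal of $\mathfrak L(\mathfrak g)$ regarded as an $\mathfrak L(\mathfrak g)$-module under the adjoint action. Then: (1) $H^1(\mathfrak L(\mathfrak g),\widetilde{\mathfrak g})=0$; (2) $\mathrm{Der}(\mathfrak L(\mathfrak g),\mathfrak L(\mathfrak g))=\mathrm{Inn}(\mathfrak L(\mathfrak g))$, i.e. every derivation of $\mathfrak L(\mathfrak g)$ is inner.
   Context: All vector spaces, algebras and tensor products are over $\mathbb C$. Let $(\cdot,\cdot)$ be the Killing form of $\mathfrak g$. The affine-Virasoro Lie algebra is the vector space $\mathfrak L(\mathfrak g)=(\mathfrak g\otimes\mathbb C[t^{\pm1}])\oplus\mathbb C K_1\oplus\mathbb C K_2\oplus\bigoplus_{m\in\mathbb Z}\mathbb C d_m$ with brackets, for $x,y\in\mathfrak g$, $m,n\in\mathbb Z$: $[x\otimes t^m,y\otimes t^n]=[x,y]\otimes t^{m+n}+m(x,y)\delta_{m+n,0}K_1$; $[\mathfrak L(\mathfrak g),K_1]=[\mathfrak L(\mathfrak g),K_2]=0$; $[d_m,x\otimes t^n]=n\,x\otimes t^{m+n}$; $[d_m,d_n]=(n-m)d_{m+n}+\delta_{m+n,0}\frac{m^3-m}{12}K_2$. For a Lie algebra $\mathfrak G$ and a $\mathfrak G$-module $V$, a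 derivation from $\mathfrak G$ to $V$ is a linear map $D:\mathfrak G\to V$ with $D([x,y])=x.D(y)-y.D(x)$ for all $x,y\in\mathfrak G$; it is inner if there is $v\in V$ with $D(x)=x.v$ for all $x\in\mathfrak G$. $\mathrm{Der}(\mathfrak G,V)$ and $\mathrm{Inn}(\mathfrak G,V)$ denote the spaces of derivations and inner derivations, $H^1(\mathfrak G,V)=\mathrm{Der}(\mathfrak G,V)/\mathrm{Inn}(\mathfrak G,V)$, and $\mathrm{Inn}(\mathfrak G)=\mathrm{Inn}(\mathfrak G,\mathfrak G)$ for the adjoint module. *)

(* Defs.v *)
From HB Require Import structures.
From mathcomp Require Import all_boot all_order all_algebra.
From mathcomp Require Import ring_quotient finmap monalg complex ring.
From mathcomp Require Import boolp classical_sets functions reals.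

Set Implicit Arguments.
Unset Strict Implicit.
Unset Printing Implicit Defensive.

Import Order.TTheory GRing.Theory Num.Theory.
Local Open Scope ring_scope.

HB.mixin Record Lmodule_isLieAlgebra (K : fieldType) L of GRing.Lmodule K L := {
  lieb : L -> L -> L;
  lieb_linearl : forall y, linear (lieb^~ y);
  lieb_linearr : forall x, linear (lieb x);
  lieb_alt : forall x, lieb x x = 0;
  lieb_jacobi : forall x y z,
    lieb x (lieb y z) + lieb y (lieb z x) + lieb z (lieb x y) = 0
}.

#[short(type="lieAlgType")]
HB.structure Definition LieAlgebra (K : fieldType) :=
  {L of GRing.Lmodule K L & Lmodule_isLieAlgebra K L}.

#[short(type="finLieAlgType")]
HB.structure Definition FinLieAlgebra (K : fieldType) :=
  {L of Vector K L & Lmodule_isLieAlgebra K L}.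

Notation "[ 'lie' x , y ]" := (lieb x y)
  (at level 0, x, y at level 200, format "[ 'lie'  x ,  y ]") : ring_scope.

HB.mixin Record Lmodule_isLieModule (K : fieldType) (G : lieAlgType K) V
    of GRing.Lmodule K V := {
  lact : G -> V -> V;
  lact_linearl : forall v, linear (lact^~ v);
  lact_linearr : forall x, linear (lact x);
  lact_lieb : forall x y v,
    lact [lie x, y] v = lact x (lact y v) - lact y (lact x v)
}.

#[short(type="lieModType")]
HB.structure Definition LieModule (K : fieldType) (G : lieAlgType K) :=
  {V of GRing.Lmodule K V & Lmodule_isLieModule K G V}.

Section LieAlgebraTheory.
Variables (K : fieldType) (G : lieAlgType K).
Implicit Types x y z : G.

HB.instance Definition _ x :=
  GRing.isLinear.Build K G G _ (lieb x) (lieb_linearr x).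

Lemma liebDl x y z : [lie x + y, z] = [lie x, z] + [lie y, z].
Proof. by have /= := lieb_linearl z 1 x y; rewrite !scale1r. Qed.

Lemma liebDr x y z : [lie x, y + z] = [lie x, y] + [lie x, z].
Proof. exact: linearD. Qed.

Lemma liebC x y : [lie x, y] = - [lie y, x].
Proof.
apply/eqP; rewrite -addr_eq0; apply/eqP.
by have := lieb_alt (x + y); rewrite liebDl !liebDr !lieb_alt add0r addr0.
Qed.

Lemma liebNl x y : [lie - x, y] = - [lie x, y].
Proof. by rewrite liebC linearN opprK; exact: liebC. Qed.

Lemma liebZl a x y : [lie a *: x, y] = a *: [lie x, y].
Proof. by rewrite liebC linearZ /= [in RHS]liebC scalerN. Qed.

Lemma lieb0l y : [lie 0, y] = 0.
Proof. by rewrite liebC linear0 oppr0. Qed.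

Lemma lieb_ad x y z : [lie [lie x, y], z] = [lie x, [lie y, z]] - [lie y, [lie x, z]].
Proof.
have := lieb_jacobi x y z; rewrite (liebC z x) (liebC z [lie x, y]) linearN /=.
by move/eqP; rewrite subr_eq0 => /eqP <-.
Qed.

End LieAlgebraTheory.

(* A copy of [G], so that the module structure does not sit on [G] itself. *)
Definition adjoint (K : fieldType) (G : lieAlgType K) : Type := G.

HB.instance Definition _ (K : fieldType) (G : lieAlgType K) :=
  GRing.Lmodule.on (adjoint G).

HB.instance Definition _ (K : fieldType) (G : lieAlgType K) :=
  Lmodule_isLieModule.Build K G (adjoint G)
    (@lieb_linearl K G) (@lieb_linearr K G) (@lieb_ad K G).

Section Derivations.
Variables (K : fieldType) (G : lieAlgType K) (V : lieModType G).

Definition Der : set (G -> V) := fun D =>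
  linear D /\
  forall x y, D [lie x, y] = lact x (D y) - lact y (D x).

Definition Inn : set (G -> V) := fun D => exists v, forall x, D x = lact x v.

Lemma lact0r (x : G) : lact x (0 : V) = 0. Proof. by have := lact_linearr x (-1) 0 (0 : V); rewrite scaler0 addr0 scaleN1r addNr. Qed.

Definition der_pred : {pred G -> V} := fun D => `[< Der D >].

Lemma der_pred_closed : submod_closed der_pred.
Proof.
split=> [|a D E /asboolP[lD dD] /asboolP[lE dE]]; apply/asboolP; split.
- by move=> c x y; rewrite scaler0 addr0.
- by move=> x y; rewrite !lact0r subrr.
- move=> c x y; rewrite !fctE lD lE !scalerDr !scalerA [a * c]mulrC.
  by rewrite addrACA.
- move=> x y; rewrite !fctE dD dE !lact_linearr scalerBr opprD.
  by rewrite addrACA.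
Qed.

HB.instance Definition _ :=
  GRing.isSubmodClosed.Build K (G -> V) der_pred
    (GRing.submod_closed_semi der_pred_closed).

Record derSpace := DerSpace { der_fun :> G -> V; _ : der_fun \in der_pred }.

HB.instance Definition _ := [isSub for der_fun].
HB.instance Definition _ := [Choice of derSpace by <:].
HB.instance Definition _ := [SubChoice_isSubLmodule of derSpace by <:].

Lemma derSpaceP (D : derSpace) : Der D.
Proof. by case: D => D /= /asboolP. Qed.

Lemma Inn_sub_Der : (Inn `<=` Der)%classic.
Proof.
move=> D [v Dv]; split=> [a x y|x y]; first by rewrite !Dv lact_linearl.
by rewrite !Dv lact_lieb.
Qed.

Definition inn_pred : {pred derSpace} := fun D => `[< Inn D >].

Lemma inn_pred_closed : submod_closed inn_pred.
Proof.
split=> [|a D E /asboolP[v Dv] /asboolP[w Ew]]; apply/asboolP.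
  by exists 0 => x; rewrite lact0r.
exists (a *: v + w) => x; rewrite lact_linearr -Dv -Ew.
by rewrite -[der_fun _]/(val _) linearP.
Qed.

HB.instance Definition _ :=
  GRing.isSubmodClosed.Build K derSpace inn_pred
    (GRing.submod_closed_semi inn_pred_closed).

Definition H1 : Type := Quotient.quot inn_pred.

HB.instance Definition _ := GRing.Zmodule.on H1.
HB.instance Definition _ := EqQuotient.on H1.

Local Open Scope quotient_scope.

Definition H1_scale (a : K) (h : H1) : H1 := \pi_H1 (a *: repr h).

Lemma H1_scale_pi a (D : derSpace) : H1_scale a (\pi_H1 D) = \pi_H1 (a *: D).
Proof.
apply/eqP; rewrite -[_ == _]/(_ == _ %[mod Quotient.quot inn_pred]).
rewrite -Quotient.idealrBE -scalerBr rpredZ // Quotient.idealrBE.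
by rewrite reprK.
Qed.

Lemma H1_piD (D E : derSpace) : \pi_H1 (D + E) = \pi_H1 D + \pi_H1 E.
Proof. exact: Quotient.pi_add. Qed.

Fact H1_scaleA a b h : H1_scale a (H1_scale b h) = H1_scale (a * b) h.
Proof. by rewrite [H1_scale b h]/H1_scale H1_scale_pi scalerA. Qed.

Fact H1_scale1 : left_id 1 H1_scale.
Proof. by move=> h; rewrite /H1_scale scale1r reprK. Qed.

Fact H1_scaleDr : right_distributive H1_scale +%R.
Proof.
move=> a h k; rewrite -[h]reprK -[k]reprK; move: (repr h) (repr k) => D E.
by rewrite -H1_piD !H1_scale_pi scalerDr H1_piD.
Qed.

Fact H1_scaleDl h : {morph H1_scale^~ h : a b / a + b}.
Proof. by move=> a b; rewrite /H1_scale scalerDl H1_piD. Qed.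

HB.instance Definition _ := GRing.Zmodule_isLmodule.Build K H1
  H1_scaleA H1_scale1 H1_scaleDr H1_scaleDl.

Lemma H1_pi_eq0 (D : derSpace) : (\pi_H1 D = 0) <-> Inn D.
Proof.
have ->: (0 : H1) = \pi_H1 0 by apply: (addrI (\pi_H1 0)); rewrite -H1_piD !addr0.
split=> [/eqP|DI]; last apply/eqP.
  by rewrite -Quotient.idealrBE subr0 => /asboolP.
by rewrite -Quotient.idealrBE subr0; apply/asboolP.
Qed.

End Derivations.

Arguments Der {K} G V.
Arguments Inn {K} G V.
Arguments H1 {K} G V.

Definition lie_simple (K : fieldType) (g : finLieAlgType K) : Prop :=
  (exists x y : g, [lie x, y] <> 0) /\
  forall I : {vspace g}, (forall x y : g, y \in I -> [lie x, y] \in I) ->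
    I = 0%VS \/ I = fullv.

Section Killing.
Variables (K : fieldType) (g : finLieAlgType K).
Implicit Types x y z : g.

Definition lie_ad x : 'End(g) := linfun (lieb x).

Definition lfun_trace (f : 'End(g)) : K :=
  \tr (passmx.mxof (vbasis {:g}) (vbasis {:g}) f).

Definition killing x y : K := lfun_trace (lie_ad x \o lie_ad y)%VF.

Lemma lie_adE x y : lie_ad x y = [lie x, y].
Proof. by rewrite lfunE. Qed.

Lemma lie_ad_linear : linear lie_ad.
Proof.
by move=> a x y; apply/lfunP => z; rewrite !lfunE /= !lfunE /= liebDl liebZl !lfunE.
Qed.

Lemma lie_ad_lieb x y :
  lie_ad [lie x, y] = (lie_ad x \o lie_ad y)%VF - (lie_ad y \o lie_ad x)%VF.
Proof. by apply/lfunP => z; rewrite !lfunE /= !lfunE /= !lfunE /= !lfunE /= lieb_ad. Qed.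

Lemma lfun_trace_linear : linear_for *%R lfun_trace.
Proof. by move=> a f h; rewrite /lfun_trace passmx.mxof_linear mxtraceD mxtraceZ. Qed.

Lemma lfun_traceC f h : lfun_trace (f \o h)%VF = lfun_trace (h \o f)%VF.
Proof.
rewrite /lfun_trace !(passmx.mxof_comp _ _ (vbasisP _)).
exact: mxtrace_mulC.
Qed.

Lemma lfun_traceB f h : lfun_trace (f - h) = lfun_trace f - lfun_trace h.
Proof. by rewrite -scaleN1r addrC lfun_trace_linear mulN1r addrC. Qed.

Lemma killingC x y : killing x y = killing y x.
Proof. exact: lfun_traceC. Qed.

Lemma killing_linearl y : linear_for *%R (killing^~ y).
Proof.
by move=> a x z; rewrite /killing lie_ad_linear comp_lfunDl -comp_lfunZl lfun_trace_linear.
Qed.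

Lemma killing_linearr x : linear_for *%R (killing x).
Proof. by move=> a y z; rewrite !(killingC x) killing_linearl. Qed.

Lemma killing_invariant x y z : killing [lie x, y] z = killing x [lie y, z].
Proof.
rewrite /killing !lie_ad_lieb comp_lfunDl comp_lfunDr comp_lfunNl comp_lfunNr.
rewrite !lfun_traceB; congr (_ - _); first by rewrite comp_lfunA.
by rewrite -comp_lfunA lfun_traceC comp_lfunA.
Qed.

End Killing.

(* The element $\sum_i v_i \otimes t^i$ is encoded as the finitely supported
   family $(v_i)_{i \in \mathbb{Z}}$. *)
Definition laurent (K : fieldType) (V : lmodType K) : Type := {malg V[int]}.

Section Laurent.
Variables (K : fieldType).

Section Lmod.
Variable V : lmodType K.

HB.instance Definition _ := GRing.Zmodule.on (laurent V).

Definition lmono (m : int) (x : V) : laurent V := << x *g m >>.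

Definition lcoef (f : laurent V) (m : int) : V := f@_m.

Definition lscale (a : K) (f : laurent V) : laurent V :=
  [malg m in msupp f => a *: f@_m].

Fact lscaleE a (f : laurent V) (k : int) : mcoeff k (lscale a f) = a *: mcoeff k f.
Proof. by rewrite mcoeffE; case: msuppP; rewrite ?scaler0. Qed.

Fact lscaleA a b f : lscale a (lscale b f) = lscale (a * b) f.
Proof. by apply/malgP => k; rewrite !lscaleE scalerA. Qed.

Fact lscale1 : left_id 1 lscale.
Proof. by move=> f; apply/malgP => k; rewrite lscaleE scale1r. Qed.

Fact lscaleDr : right_distributive lscale +%R.
Proof. by move=> a f h; apply/malgP => k; rewrite !(lscaleE, mcoeffD) scalerDr. Qed.

Fact lscaleDl f : {morph lscale^~ f : a b / a + b}.
Proof. by move=> a b; apply/malgP => k; rewrite !(lscaleE, mcoeffD) scalerDl. Qed.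

HB.instance Definition _ := GRing.Zmodule_isLmodule.Build K (laurent V)
  lscaleA lscale1 lscaleDr lscaleDl.

Lemma laurentP (f h : laurent V) : (forall m, lcoef f m = lcoef h m) <-> f = h.
Proof. exact: malgP. Qed.

Lemma lcoef_linear m : linear (lcoef^~ m).
Proof. by move=> a f h; rewrite /lcoef mcoeffD lscaleE. Qed.

Lemma lcoef_mono m n x : lcoef (lmono m x) n = x *+ (m == n).
Proof. exact: mcoeffU. Qed.

Lemma lmono_linear m : linear (lmono m).
Proof.
move=> a x y; apply/laurentP => k; rewrite lcoef_linear !lcoef_mono.
by case: eqP => _; rewrite ?scaler0 ?addr0.
Qed.

Lemma lmonoD m x y : lmono m (x + y) = lmono m x + lmono m y.
Proof. exact: monalgUD. Qed.

Lemma lmonoN m x : lmono m (- x) = - lmono m x.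
Proof. exact: monalgUN. Qed.

Lemma lmono0 m : lmono m 0 = 0.
Proof. exact: monalgU0. Qed.

Lemma lmonoZ m a x : lmono m (a *: x) = a *: lmono m x.
Proof. by have := lmono_linear m a x 0; rewrite lmono0 !addr0. Qed.

Lemma laurent_ind (P : laurent V -> Prop) :
  (forall m x, P (lmono m x)) -> (forall f h, P f -> P h -> P (f + h)) ->
  forall f, P f.
Proof.
move=> Pm PD f; rewrite [f]monalgE; elim/big_rec: _ => [|i h _ Ph].
  by rewrite -(lmono0 0); apply: Pm.
by apply: PD => //; apply: Pm.
Qed.

End Lmod.

(* [lext F] maps $\sum_i v_i \otimes t^i$ to $\sum_i F_i(v_i)$. *)
Definition lext (V W : lmodType K) (F : int -> V -> W) (f : laurent V) : W :=
  \sum_(i <- msupp f) F i (lcoef f i).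

(* The bilinear map sending $(u \otimes t^i, v \otimes t^j)$ to $F_{i,j}(u, v)$. *)
Definition lext2 (U V W : lmodType K) (F : int -> int -> U -> V -> W)
    (f : laurent U) (h : laurent V) : W :=
  lext (fun i x => lext (fun j y => F i j x y) h) f.

Definition bilin (U V W : lmodType K) (B : U -> V -> W) :=
  (forall v, linear (B^~ v)) /\ (forall u, linear (B u)).

Section Ext.
Variables (V W : lmodType K).

Let linear00 (F : V -> W) : linear F -> F 0 = 0.
Proof. by move=> /(_ (-1) 0 0); rewrite scaler0 addr0 scaleN1r addNr. Qed.

Lemma lextEw (F : int -> V -> W) (f : laurent V) (d : {fset int}) :
  (forall i, linear (F i)) -> (msupp f `<=` d)%fset ->
  lext F f = \sum_(i <- d) F i (lcoef f i).
Proof.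
move=> Fl sfd; rewrite /lext; apply: big_fset_incl => // i _ ni.
by rewrite /lcoef mcoeff_outdom // linear00.
Qed.

Lemma lext_linear (F : int -> V -> W) :
  (forall i, linear (F i)) -> linear (lext F).
Proof.
move=> Fl a f h; pose d := (msupp f `|` msupp h `|` msupp (a *: f + h))%fset.
rewrite !(@lextEw F _ d) //; last first.
- by apply/fsubsetP => i; rewrite !inE => ->; rewrite orbT.
- by apply/fsubsetP => i; rewrite !inE => ->.
- by apply/fsubsetP => i; rewrite !inE => ->; rewrite !orbT.
rewrite scaler_sumr -big_split /=; apply: eq_bigr => i _.
by rewrite lcoef_linear Fl.
Qed.

Lemma lext_mono (F : int -> V -> W) m x :
  (forall i, linear (F i)) -> lext F (lmono m x) = F m x.
Proof.
move=> Fl; rewrite (@lextEw F _ [fset m]%fset) ?msuppU_le //.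
by rewrite big_seq_fset1 lcoef_mono eqxx.
Qed.

Lemma lext_funlin (F G H : int -> V -> W) a (f : laurent V) :
  (forall i x, H i x = a *: F i x + G i x) ->
  lext H f = a *: lext F f + lext G f.
Proof.
move=> HE; rewrite /lext scaler_sumr -big_split /=.
by apply: eq_bigr => i _; rewrite HE.
Qed.

End Ext.

Section Ext2.
Variables (U V W : lmodType K) (F : int -> int -> U -> V -> W).
Hypothesis Fb : forall i j, bilin (F i j).

Lemma lext2_bilin : bilin (lext2 F).
Proof.
split=> [h|f]; rewrite /lext2.
  apply: lext_linear => i a x y.
  by apply: lext_funlin => j z; rewrite (Fb i j).1.
move=> a h k; apply: lext_funlin => i x.
by rewrite lext_linear // => j; exact: (Fb i j).2.
Qed.

Lemma lext2_mono m n x y : lext2 F (lmono m x) (lmono n y) = F m n x y.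
Proof.
rewrite /lext2 lext_mono => [|i a u v].
  by rewrite lext_mono // => j; exact: (Fb m j).2.
by apply: lext_funlin => j z; rewrite (Fb i j).1.
Qed.

End Ext2.
End Laurent.

Local Lemma add3 (W : zmodType) (a1 a2 b1 b2 c1 c2 : W) :
  a1 + a2 + (b1 + b2) + (c1 + c2) = (a1 + b1 + c1) + (a2 + b2 + c2).
Proof. by rewrite (addrACA a1) [LHS]addrACA. Qed.

Section Bilin.
Variables (K : fieldType) (U V W : lmodType K) (B : U -> V -> W).
Hypothesis Bb : bilin B.

Lemma bilinDl x y z : B (x + y) z = B x z + B y z.
Proof. by have := Bb.1 z 1 x y; rewrite !scale1r. Qed.
Lemma bilinDr x y z : B x (y + z) = B x y + B x z.
Proof. by have := Bb.2 x 1 y z; rewrite !scale1r. Qed.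
Lemma bilin0l z : B 0 z = 0.
Proof. by have := Bb.1 z (-1) 0 0; rewrite scaler0 addr0 scaleN1r addNr. Qed.
Lemma bilin0r z : B z 0 = 0.
Proof. by have := Bb.2 z (-1) 0 0; rewrite scaler0 addr0 scaleN1r addNr. Qed.
Lemma bilinNl x z : B (- x) z = - B x z.
Proof. by apply/eqP; rewrite -addr_eq0 -bilinDl addNr bilin0l. Qed.
Lemma bilinNr x z : B x (- z) = - B x z.
Proof. by apply/eqP; rewrite -addr_eq0 -bilinDr addNr bilin0r. Qed.

End Bilin.

(* Closes [t1 + (t2 + ... (tn + 0)) = 0] when the terms cancel in pairs. *)
Local Ltac zcancel :=
  repeat match goal with
  | |- - ?x + _ = 0 => do ?rewrite (addrCA _ x); rewrite addNKr
  | |- ?x + _ = 0 => do ?rewrite (addrCA _ (- x)); rewrite addKr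
  end; reflexivity.

Section Additivity.
Variables (K : fieldType) (U P W : lmodType K).
Variables (A : P -> U -> U) (B : U -> U -> U) (C : U -> U -> W) (D : P -> P -> P).
Hypotheses (Ab : bilin A) (Bb : bilin B) (Cb : bilin C) (Db : bilin D).
Let rl := (bilinDl Ab, bilinDl Bb, bilinDl Cb, bilinDl Db).
Let rr := (bilinDr Ab, bilinDr Bb, bilinDr Cb, bilinDr Db).

Lemma semidirect_linl a f p f' p' h q :
  B (a *: f + f') h + A (a *: p + p') h - A q (a *: f + f')
  = a *: (B f h + A p h - A q f) + (B f' h + A p' h - A q f').
Proof. by rewrite Bb.1 Ab.1 Ab.2 scalerBr scalerDr [X in X - _ = _]addrACA opprD [LHS]addrACA. Qed.

Lemma semidirect_linr a f p h q h' q' :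
  B f (a *: h + h') + A p (a *: h + h') - A (a *: q + q') f
  = a *: (B f h + A p h - A q f) + (B f h' + A p h' - A q' f).
Proof. by rewrite Bb.2 Ab.1 Ab.2 scalerBr scalerDr [X in X - _ = _]addrACA opprD [LHS]addrACA. Qed.

Definition cyc_sum a b c : W := C a (B b c) + C b (B c a) + C c (B a b).

Lemma cyc_sumC a b c : cyc_sum a b c = cyc_sum b c a.
Proof. by rewrite /cyc_sum [RHS]addrC addrA. Qed.

Lemma cyc_sumD a1 a2 b c : cyc_sum (a1 + a2) b c = cyc_sum a1 b c + cyc_sum a2 b c.
Proof. by rewrite /cyc_sum !(rl, rr) add3. Qed.

Definition der_law p f h := A p (B f h) = B (A p f) h + B f (A p h).

Lemma der_lawD1 p q f h : der_law p f h -> der_law q f h -> der_law (p + q) f h.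
Proof. by rewrite /der_law !(rl, rr) => -> ->; rewrite addrACA. Qed.

Lemma der_lawD2 p f1 f2 h :
  der_law p f1 h -> der_law p f2 h -> der_law p (f1 + f2) h.
Proof. by rewrite /der_law !(rl, rr) => -> ->; rewrite addrACA. Qed.

Lemma der_lawD3 p f h1 h2 :
  der_law p f h1 -> der_law p f h2 -> der_law p f (h1 + h2).
Proof. by rewrite /der_law !(rl, rr) => -> ->; rewrite addrACA. Qed.

Definition rep_law p q f := A (D p q) f = A p (A q f) - A q (A p f).

Lemma rep_lawD1 p1 p2 q f :
  rep_law p1 q f -> rep_law p2 q f -> rep_law (p1 + p2) q f.
Proof. by rewrite /rep_law !(rl, rr) => -> ->; rewrite opprD addrACA. Qed.

Lemma rep_lawD2 p q1 q2 f :
  rep_law p q1 f -> rep_law p q2 f -> rep_law p (q1 + q2) f.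
Proof. by rewrite /rep_law !(rl, rr) => -> ->; rewrite opprD addrACA. Qed.

Lemma rep_lawD3 p q f1 f2 :
  rep_law p q f1 -> rep_law p q f2 -> rep_law p q (f1 + f2).
Proof. by rewrite /rep_law !(rl, rr) => -> ->; rewrite opprD addrACA. Qed.

Definition sym_law p f h := C f (A p h) = C h (A p f).

Lemma sym_lawD1 p q f h : sym_law p f h -> sym_law q f h -> sym_law (p + q) f h.
Proof. by rewrite /sym_law !(rl, rr) => -> ->. Qed.

Lemma sym_lawD2 p f1 f2 h :
  sym_law p f1 h -> sym_law p f2 h -> sym_law p (f1 + f2) h.
Proof. by rewrite /sym_law !(rl, rr) => -> ->. Qed.

Lemma sym_lawD3 p f h1 h2 :
  sym_law p f h1 -> sym_law p f h2 -> sym_law p f (h1 + h2).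
Proof. by rewrite /sym_law !(rl, rr) => -> ->. Qed.

Definition skew_law a b := C a b = - C b a.

Lemma skew_lawD1 a1 a2 b : skew_law a1 b -> skew_law a2 b -> skew_law (a1 + a2) b.
Proof. by rewrite /skew_law !(rl, rr) => -> ->; rewrite opprD. Qed.

Lemma skew_lawD2 a b1 b2 : skew_law a b1 -> skew_law a b2 -> skew_law a (b1 + b2).
Proof. by rewrite /skew_law !(rl, rr) => -> ->; rewrite opprD. Qed.

Hypotheses (Ader : forall p f h, der_law p f h) (Arep : forall p q f, rep_law p q f).
Hypothesis Csym : forall p f h, sym_law p f h.

Lemma semidirect_jacobi :
  (forall f h, B f h = - B h f) ->
  (forall f h k, B f (B h k) + B h (B k f) + B k (B f h) = 0) ->
  forall f h k p q r,
    (B f (B h k + A q k - A r h) + A p (B h k + A q k - A r h) - A (D q r) f)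
  + (B h (B k f + A r f - A p k) + A q (B k f + A r f - A p k) - A (D r p) h)
  + (B k (B f h + A p h - A q f) + A r (B f h + A p h - A q f) - A (D p q) k)
  = 0.
Proof.
move=> Bskew Bjac f h k p q r.
rewrite !(rr, bilinNr Bb, bilinNr Ab) !Ader !Arep.
rewrite (Bskew (A p h)) (Bskew (A q k)) (Bskew (A r f)).
have -> : B f (B h k) = - (B h (B k f) + B k (B f h)).
  by apply/eqP; rewrite -addr_eq0 addrA Bjac.
rewrite !opprD !opprK -[LHS]addr0 -!addrA; zcancel.
Qed.

Lemma cocycle_jacobi :
  (forall f h k, C f (B h k) + C h (B k f) + C k (B f h) = 0) ->
  forall f h k p q r,
    C f (B h k + A q k - A r h) + C h (B k f + A r f - A p k)
  + C k (B f h + A p h - A q f) = 0.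
Proof.
move=> Cjac f h k p q r; rewrite !(rr, bilinNr Cb).
rewrite (Csym q k f) (Csym p k h) (Csym r h f).
have -> : C f (B h k) = - (C h (B k f) + C k (B f h)).
  by apply/eqP; rewrite -addr_eq0 addrA Cjac.
rewrite !opprD -[LHS]addr0 -!addrA; zcancel.
Qed.

End Additivity.

Section LaurentAdditivity.
Variables (K : fieldType) (V X W : lmodType K).
Variables (B : laurent V -> laurent V -> laurent V) (C : laurent V -> laurent V -> W).
Hypotheses (Bb : bilin B) (Cb : bilin C).

Lemma cyc_sum0 :
  (forall i j k x y z, cyc_sum B C (lmono i x) (lmono j y) (lmono k z) = 0) ->
  forall a b c, cyc_sum B C a b c = 0.
Proof.
move=> H; elim/laurent_ind => [i x|a1 a2 H1 H2] b c; last first.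
  by rewrite cyc_sumD // H1 H2 addr0.
elim/laurent_ind: b c => [j y|a1 a2 H1 H2] c; last first.
  by rewrite cyc_sumC cyc_sumD // -cyc_sumC H1 -cyc_sumC H2 addr0.
elim/laurent_ind: c => [k z|a1 a2 H1 H2]; first exact: H.
by rewrite -cyc_sumC cyc_sumD // cyc_sumC H1 cyc_sumC H2 addr0.
Qed.

Lemma laurent_skew :
  (forall i j x y, C (lmono i x) (lmono j y) = - C (lmono j y) (lmono i x)) ->
  forall a b, C a b = - C b a.
Proof.
move=> H; elim/laurent_ind => [i x|a1 a2 H1 H2] b; last exact: skew_lawD1.
elim/laurent_ind: b => [j y|b1 b2 H1 H2]; last exact: skew_lawD2.
exact: H.
Qed.

End LaurentAdditivity.

Section AffineVirasoro.
Variables (K : numFieldType) (g : finLieAlgType K).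

(* Coordinates: $\mathfrak{g} \otimes K[t^{\pm 1}]$, the coefficient of $K_1$,
   the coefficient of $K_2$, and $\bigoplus_m K d_m$, where the monomial of
   exponent [m] stands for $d_m$. *)
Definition affVir : Type := (laurent g * K^o * K^o * laurent K^o)%type.

HB.instance Definition _ := GRing.Lmodule.on affVir.

Implicit Types (u v w : affVir) (f h : laurent g) (p q : laurent K^o).

Definition av_loop u : laurent g := u.1.1.1.
Definition av_K1 u : K^o := u.1.1.2.
Definition av_K2 u : K^o := u.1.2.
Definition av_vir u : laurent K^o := u.2.

Definition loop_br : laurent g -> laurent g -> laurent g :=
  lext2 (fun m n x y => lmono (m + n) [lie x, y]).

Definition loop_cocycle : laurent g -> laurent g -> K^o :=
  lext2 (W := K^o) (fun m n (x y : g) =>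
    if m + n == 0 then m%:~R * killing x y else 0).

Definition vir_loop : laurent K^o -> laurent g -> laurent g :=
  lext2 (fun m n (a : K^o) (x : g) => lmono (m + n) ((a * n%:~R) *: x)).

Definition vir_br : laurent K^o -> laurent K^o -> laurent K^o :=
  lext2 (fun m n (a b : K^o) =>
    lmono (m + n) (a * b * (n - m)%:~R : K^o)).

Definition vir_cocycle : laurent K^o -> laurent K^o -> K^o :=
  lext2 (W := K^o) (fun m n (a b : K^o) =>
    if m + n == 0 then a * b * ((m ^+ 3 - m)%:~R / 12%:R) else 0).

Definition av_br u v : affVir :=
  (loop_br (av_loop u) (av_loop v)
     + vir_loop (av_vir u) (av_loop v) - vir_loop (av_vir v) (av_loop u),
   loop_cocycle (av_loop u) (av_loop v),
   vir_cocycle (av_vir u) (av_vir v),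
   vir_br (av_vir u) (av_vir v)).

Let regE (a b : K) : (a : K) *: (b : K^o) = a * b. Proof. by []. Qed.

Let loop_br_mon (i j : int) :
  bilin (fun x y : g => lmono (i + j) [lie x, y]).
Proof.
split=> y a x z; first by rewrite lieb_linearl lmono_linear.
by rewrite lieb_linearr lmono_linear.
Qed.

Let loop_cocycle_mon (m n : int) : bilin (W := K^o) (fun x y : g =>
  if m + n == 0 then m%:~R * killing x y else 0 : K^o).
Proof.
split=> y a x z; case: eqP => _; rewrite ?scaler0 ?addr0 //.
  by rewrite killing_linearl mulrDr mulrCA.
by rewrite killing_linearr mulrDr mulrCA.
Qed.

Let vir_loop_mon (m n : int) :
  bilin (fun (a : K^o) (x : g) => lmono (m + n) ((a * n%:~R) *: x)).
Proof.
split=> [x c a b|a c x y]; rewrite -lmono_linear; congr (lmono _ _).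
  by rewrite scalerA -scalerDl mulrDl -scalerAl.
by rewrite scalerDr !scalerA mulrC.
Qed.

Let vir_br_mon (m n : int) : bilin (fun a b : K^o =>
  lmono (m + n) (a * b * (n - m)%:~R : K^o)).
Proof.
split=> [x c a b|a c x y]; rewrite -lmono_linear; congr (lmono _ _).
  by rewrite !regE !mulrDl !mulrA.
by rewrite !regE mulrDr mulrDl [a * (c * x)]mulrCA !mulrA.
Qed.

Let vir_cocycle_mon (m n : int) : bilin (U := K^o) (V := K^o) (W := K^o) (fun a b : K^o =>
  if m + n == 0 then a * b * ((m ^+ 3 - m)%:~R / 12%:R) else 0).
Proof.
split=> [x c a b|a c x y]; case: eqP => _; rewrite ?scaler0 ?addr0 //.
  by rewrite !regE !mulrDl !mulrA.
by rewrite !regE mulrDr mulrDl [a * (c * x)]mulrCA !mulrA.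
Qed.

Lemma loop_br_bilin : bilin loop_br. Proof. exact: lext2_bilin. Qed.
Lemma loop_cocycle_bilin : bilin loop_cocycle. Proof. exact: lext2_bilin. Qed.
Lemma vir_loop_bilin : bilin vir_loop. Proof. exact: lext2_bilin. Qed.
Lemma vir_br_bilin : bilin vir_br. Proof. exact: lext2_bilin. Qed.
Lemma vir_cocycle_bilin : bilin vir_cocycle. Proof. exact: lext2_bilin. Qed.

Lemma loop_br_mono m n x y :
  loop_br (lmono m x) (lmono n y) = lmono (m + n) [lie x, y].
Proof. exact: lext2_mono. Qed.

Lemma loop_cocycle_mono m n x y : loop_cocycle (lmono m x) (lmono n y) =
  if m + n == 0 then m%:~R * killing x y else 0.
Proof. exact: (lext2_mono loop_cocycle_mon). Qed.

Lemma vir_loop_mono m n (a : K^o) x :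
  vir_loop (lmono m a) (lmono n x) = lmono (m + n) ((a * n%:~R) *: x).
Proof. exact: lext2_mono. Qed.

Lemma vir_br_mono m n (a b : K^o) : vir_br (lmono m a) (lmono n b) =
  lmono (m + n) (a * b * (n - m)%:~R : K^o).
Proof. exact: lext2_mono. Qed.

Lemma vir_cocycle_mono m n (a b : K^o) :
  vir_cocycle (lmono m a) (lmono n b) =
  if m + n == 0 then a * b * ((m ^+ 3 - m)%:~R / 12%:R) else 0.
Proof. exact: (lext2_mono vir_cocycle_mon). Qed.

#[local] Opaque loop_br loop_cocycle vir_loop vir_br vir_cocycle lmono.

Let vir_jac_alg (x y z a b c : K) :
  x * (y * z * (c - b)) * (b + c - a) + y * (z * x * (a - c)) * (c + a - b)
  + z * (x * y * (b - a)) * (a + b - c) = 0.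
Proof. by ring. Qed.

Let vir_loop_alg (x y a b c : K) :
  x * y * (b - a) * c + y * (a + c) * (x * c) = x * (b + c) * (y * c).
Proof. by ring. Qed.

Let coc_act_alg (x a b k : K) : a * (x * b * k) = b * (x * a * k).
Proof. by ring. Qed.

Let vir_coc_alg (x y z a b c t : K) : a = - b - c ->
  x * (y * z * (c - b)) * ((a ^+ 3 - a) / t)
  + y * (z * x * (a - c)) * ((b ^+ 3 - b) / t)
  + z * (x * y * (b - a)) * ((c ^+ 3 - c) / t) = 0.
Proof. by move=> ->; move: (t^-1) => s; ring. Qed.

Let skew_diag (W : lmodType K) (x : W) : x = - x -> x = 0.
Proof.
move/eqP; rewrite -addr_eq0 -mulr2n -scaler_nat scaler_eq0 pnatr_eq0 /=.
by move/eqP.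
Qed.

Lemma loop_brC f h : loop_br f h = - loop_br h f.
Proof.
move: f h; apply: (laurent_skew loop_br_bilin) => m n x y.
by rewrite !loop_br_mono liebC addrC lmonoN.
Qed.

Lemma loop_cocycleC f h : loop_cocycle f h = - loop_cocycle h f.
Proof.
move: f h; apply: (laurent_skew loop_cocycle_bilin) => m n x y.
rewrite !loop_cocycle_mono addrC killingC; case: eqP => [mn|_]; last by rewrite oppr0.
by rewrite -mulNr -mulrNz (addr0_eq mn).
Qed.

Lemma vir_brC p q : vir_br p q = - vir_br q p.
Proof.
move: p q; apply: (laurent_skew vir_br_bilin) => m n x y.
apply/eqP; rewrite -addr_eq0 !vir_br_mono addrC [n + m]addrC -lmonoD.
by rewrite [y * x]mulrC -mulrDr -intrD addrA subrK subrr mulr0 lmono0.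
Qed.

Lemma vir_cocycleC p q : vir_cocycle p q = - vir_cocycle q p.
Proof.
move: p q; apply: (laurent_skew vir_cocycle_bilin) => m n x y.
rewrite !vir_cocycle_mono addrC [y * x]mulrC.
case: eqP => [mn|_]; last by rewrite oppr0.
have -> : m = - n by apply/eqP; rewrite -addr_eq0 addrC mn.
rewrite -mulrN -mulNr -mulrNz; congr (_ * (_%:~R / _)); ring.
Qed.

Lemma loop_br_jacobi f h k : loop_br f (loop_br h k)
  + loop_br h (loop_br k f) + loop_br k (loop_br f h) = 0.
Proof.
move: f h k; apply: (cyc_sum0 loop_br_bilin loop_br_bilin) => m n r x y z; rewrite /cyc_sum.
rewrite !loop_br_mono.
have -> : n + (r + m) = m + (n + r) by ring.
have -> : r + (m + n) = m + (n + r) by ring.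
by rewrite -!lmonoD lieb_jacobi lmono0.
Qed.

Lemma vir_br_jacobi p q r : vir_br p (vir_br q r)
  + vir_br q (vir_br r p) + vir_br r (vir_br p q) = 0.
Proof.
move: p q r; apply: (cyc_sum0 vir_br_bilin vir_br_bilin) => m n r x y z; rewrite /cyc_sum.
rewrite !vir_br_mono.
have -> : n + (r + m) = m + (n + r) by ring.
have -> : r + (m + n) = m + (n + r) by ring.
rewrite -!lmonoD [X in lmono _ X](_ : _ = 0) ?lmono0 //.
by rewrite !intrB !intrD; exact: vir_jac_alg.
Qed.

Lemma vir_cocycle_jacobi p q r : vir_cocycle p (vir_br q r)
  + vir_cocycle q (vir_br r p) + vir_cocycle r (vir_br p q) = 0.
Proof.
move: p q r; apply: (cyc_sum0 vir_br_bilin vir_cocycle_bilin) => m n r x y z; rewrite /cyc_sum.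
rewrite !vir_br_mono !vir_cocycle_mono.
have -> : n + (r + m) = m + (n + r) by ring.
have -> : r + (m + n) = m + (n + r) by ring.
case: eqP => [mnr|_]; last by rewrite !addr0.
rewrite !intrB !rmorphXn /=; apply: vir_coc_alg; rewrite -mulrNz -intrB.
by congr (_%:~R); apply/eqP; rewrite -opprD -addr_eq0 mnr.
Qed.

Lemma vir_loop_der p f h : vir_loop p (loop_br f h)
  = loop_br (vir_loop p f) h + loop_br f (vir_loop p h).
Proof.
elim/laurent_ind: p => [m x|f1 f2 H1 H2]; last exact: (der_lawD1 vir_loop_bilin loop_br_bilin H1 H2).
elim/laurent_ind: f => [n y|f1 f2 H1 H2]; last exact: (der_lawD2 vir_loop_bilin loop_br_bilin H1 H2).
elim/laurent_ind: h => [r z|f1 f2 H1 H2]; last exact: (der_lawD3 vir_loop_bilin loop_br_bilin H1 H2).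
rewrite !(vir_loop_mono, loop_br_mono).
have -> : m + n + r = m + (n + r) by ring.
have -> : n + (m + r) = m + (n + r) by ring.
by rewrite -lmonoD liebZl linearZ /= -scalerDl -mulrDr -intrD.
Qed.

Lemma vir_loop_br p q f :
  vir_loop (vir_br p q) f = vir_loop p (vir_loop q f) - vir_loop q (vir_loop p f).
Proof.
elim/laurent_ind: p => [m x|f1 f2 H1 H2]; last exact: (rep_lawD1 vir_loop_bilin vir_br_bilin H1 H2).
elim/laurent_ind: q => [n y|f1 f2 H1 H2]; last exact: (rep_lawD2 vir_loop_bilin vir_br_bilin H1 H2).
elim/laurent_ind: f => [r z|f1 f2 H1 H2]; last exact: (rep_lawD3 vir_loop_bilin H1 H2).
rewrite !(vir_loop_mono, vir_br_mono).
have -> : m + n + r = m + (n + r) by ring.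
have -> : n + (m + r) = m + (n + r) by ring.
apply/eqP; rewrite eq_sym subr_eq -lmonoD !scalerA -scalerDl; apply/eqP.
by congr (lmono _ (_ *: _)); rewrite intrB !intrD; exact: (esym (vir_loop_alg _ _ _ _ _)).
Qed.

Lemma loop_cocycle_jacobi f h k : loop_cocycle f (loop_br h k)
  + loop_cocycle h (loop_br k f) + loop_cocycle k (loop_br f h) = 0.
Proof.
move: f h k; apply: (cyc_sum0 loop_br_bilin loop_cocycle_bilin) => m n r x y z; rewrite /cyc_sum.
rewrite !loop_br_mono !loop_cocycle_mono.
have -> : n + (r + m) = m + (n + r) by ring.
have -> : r + (m + n) = m + (n + r) by ring.
case: eqP => [mnr|_]; last by rewrite !addr0.
rewrite -killing_invariant [killing y _]killingC -(killing_invariant z).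
rewrite [killing [lie z, x] y]killing_invariant [killing z _]killingC.
by rewrite -!mulrDl -!intrD -addrA mnr mul0r.
Qed.

Lemma loop_cocycle_act p f h :
  loop_cocycle f (vir_loop p h) = loop_cocycle h (vir_loop p f).
Proof.
elim/laurent_ind: p => [m x|f1 f2 H1 H2]; last exact: (sym_lawD1 vir_loop_bilin loop_cocycle_bilin H1 H2).
elim/laurent_ind: f => [n y|f1 f2 H1 H2]; last exact: (sym_lawD2 vir_loop_bilin loop_cocycle_bilin H1 H2).
elim/laurent_ind: h => [r z|f1 f2 H1 H2]; last exact: (sym_lawD3 vir_loop_bilin loop_cocycle_bilin H1 H2).
rewrite !vir_loop_mono !loop_cocycle_mono.
have -> : r + (m + n) = n + (m + r) by ring.
case: eqP => // _; have kZ a (u w : g) : killing u (a *: w) = a * killing u w.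
  have k0 : killing u 0 = 0.
    by have := killing_linearr u (-1) 0 0; rewrite scaler0 addr0 mulN1r addNr.
  by have := killing_linearr u a w 0; rewrite k0 !addr0.
by rewrite !kZ [killing z y]killingC; exact: coc_act_alg.
Qed.

Lemma affVirP u v : av_loop u = av_loop v -> av_K1 u = av_K1 v ->
  av_K2 u = av_K2 v -> av_vir u = av_vir v -> u = v.
Proof.
by case: u v => [[[f a] b] p] [[[h c] d] q]; rewrite /av_loop /av_K1 /av_K2
  /av_vir /= => -> -> -> ->.
Qed.

Lemma av_loop_linear : linear av_loop. Proof. by []. Qed.
Lemma av_K1_linear : linear av_K1. Proof. by []. Qed.
Lemma av_K2_linear : linear av_K2. Proof. by []. Qed.
Lemma av_vir_linear : linear av_vir. Proof. by []. Qed.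

Lemma av_loop_br u v : av_loop (av_br u v) =
  loop_br (av_loop u) (av_loop v)
    + vir_loop (av_vir u) (av_loop v) - vir_loop (av_vir v) (av_loop u).
Proof. by []. Qed.
Lemma av_K1_br u v : av_K1 (av_br u v) = loop_cocycle (av_loop u) (av_loop v).
Proof. by []. Qed.
Lemma av_K2_br u v : av_K2 (av_br u v) = vir_cocycle (av_vir u) (av_vir v).
Proof. by []. Qed.
Lemma av_vir_br u v : av_vir (av_br u v) = vir_br (av_vir u) (av_vir v).
Proof. by []. Qed.

#[local] Opaque av_loop av_K1 av_K2 av_vir av_br.

Let av_linearD (W : lmodType K) (F : affVir -> W) u v :
  linear F -> F (u + v) = F u + F v.
Proof. by move=> /(_ 1 u v); rewrite !scale1r. Qed.

Let av_linear0 (W : lmodType K) (F : affVir -> W) : linear F -> F 0 = 0.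
Proof. by move=> /(_ (-1) 0 0); rewrite scaler0 addr0 scaleN1r addNr. Qed.

Lemma av_br_linearl v : linear (av_br^~ v).
Proof.
move=> a u w; apply: affVirP.
- rewrite av_loop_br !av_loop_linear av_vir_linear !av_loop_br.
  exact: (semidirect_linl vir_loop_bilin loop_br_bilin).
- by rewrite av_K1_br av_loop_linear av_K1_linear !av_K1_br loop_cocycle_bilin.1.
- by rewrite av_K2_br av_vir_linear av_K2_linear !av_K2_br vir_cocycle_bilin.1.
- by rewrite av_vir_br !av_vir_linear !av_vir_br vir_br_bilin.1.
Qed.

Lemma av_br_linearr u : linear (av_br u).
Proof.
move=> a v w; apply: affVirP.
- rewrite av_loop_br !av_loop_linear av_vir_linear !av_loop_br.
  exact: (semidirect_linr vir_loop_bilin loop_br_bilin).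
- by rewrite av_K1_br av_loop_linear av_K1_linear !av_K1_br loop_cocycle_bilin.2.
- by rewrite av_K2_br av_vir_linear av_K2_linear !av_K2_br vir_cocycle_bilin.2.
- by rewrite av_vir_br !av_vir_linear !av_vir_br vir_br_bilin.2.
Qed.

Lemma av_br_alt u : av_br u u = 0.
Proof.
apply: affVirP.
- rewrite av_loop_br addrK (av_linear0 av_loop_linear).
  by apply: skew_diag; exact: loop_brC.
- rewrite av_K1_br (av_linear0 av_K1_linear).
  by apply: skew_diag; exact: loop_cocycleC.
- rewrite av_K2_br (av_linear0 av_K2_linear).
  by apply: skew_diag; exact: vir_cocycleC.
- rewrite av_vir_br (av_linear0 av_vir_linear).
  by apply: skew_diag; exact: vir_brC.
Qed.

Lemma av_br_jacobi u v w :
  av_br u (av_br v w) + av_br v (av_br w u) + av_br w (av_br u v) = 0.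
Proof.
apply: affVirP.
- rewrite 2!(av_linearD _ _ av_loop_linear) (av_linear0 av_loop_linear).
  rewrite !av_loop_br !av_vir_br.
  apply: (semidirect_jacobi vir_loop_bilin loop_br_bilin).
  + exact: vir_loop_der.
  + exact: vir_loop_br.
  + exact: loop_brC.
  + exact: loop_br_jacobi.
- rewrite 2!(av_linearD _ _ av_K1_linear) (av_linear0 av_K1_linear).
  rewrite !av_K1_br !av_loop_br; apply: (cocycle_jacobi loop_cocycle_bilin).
  + exact: loop_cocycle_act.
  + exact: loop_cocycle_jacobi.
- rewrite 2!(av_linearD _ _ av_K2_linear) (av_linear0 av_K2_linear).
  by rewrite !av_K2_br !av_vir_br vir_cocycle_jacobi.
- rewrite 2!(av_linearD _ _ av_vir_linear) (av_linear0 av_vir_linear).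
  by rewrite !av_vir_br vir_br_jacobi.
Qed.

HB.instance Definition _ := Lmodule_isLieAlgebra.Build K affVir
  av_br_linearl av_br_linearr av_br_alt av_br_jacobi.

(* The generators $x \otimes t^m$, $K_1$, $K_2$ and $d_m$. *)
Definition av_xt (x : g) (m : int) : affVir := (lmono m x, 0, 0, 0).
Definition av_c1 : affVir := (0, 1, 0, 0).
Definition av_c2 : affVir := (0, 0, 1, 0).
Definition av_d (m : int) : affVir := (0, 0, 0, lmono m (1 : K^o)).

Lemma av_lieE u v : [lie u, v] = av_br u v. Proof. by []. Qed.

#[local] Transparent av_loop av_K1 av_K2 av_vir.

Let xtE x m : [/\ av_loop (av_xt x m) = lmono m x, av_K1 (av_xt x m) = 0,
  av_K2 (av_xt x m) = 0 & av_vir (av_xt x m) = 0].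
Proof. by []. Qed.

Let dE m : [/\ av_loop (av_d m) = 0, av_K1 (av_d m) = 0,
  av_K2 (av_d m) = 0 & av_vir (av_d m) = lmono m (1 : K^o)].
Proof. by []. Qed.

Let c1E : [/\ av_loop av_c1 = 0, av_K1 av_c1 = 1, av_K2 av_c1 = 0 & av_vir av_c1 = 0].
Proof. by []. Qed.

Let c2E : [/\ av_loop av_c2 = 0, av_K1 av_c2 = 0, av_K2 av_c2 = 1 & av_vir av_c2 = 0].
Proof. by []. Qed.

#[local] Opaque av_loop av_K1 av_K2 av_vir av_xt av_d av_c1 av_c2.

Lemma av_lie_xt_xt x y m n : [lie av_xt x m, av_xt y n] =
  (if m + n == 0 then m%:~R * killing x y else 0) *: av_c1
  + av_xt [lie x, y] (m + n).
Proof.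
have [xl x1 x2 xv] := xtE x m; have [yl y1 y2 yv] := xtE y n.
have [zl z1 z2 zv] := xtE [lie x, y] (m + n); have [cl c1 c2 cv] := c1E.
rewrite av_lieE; apply: affVirP.
- rewrite av_loop_br av_loop_linear xl yl zl xv yv cl loop_br_mono.
  by rewrite !(bilin0l vir_loop_bilin) scaler0 subr0 add0r addr0.
- rewrite av_K1_br av_K1_linear c1 z1 xl yl loop_cocycle_mono.
  by rewrite addr0 regE mulr1.
- by rewrite av_K2_br av_K2_linear c2 z2 xv yv (bilin0l vir_cocycle_bilin) scaler0 addr0.
- by rewrite av_vir_br av_vir_linear cv zv xv yv (bilin0l vir_br_bilin) scaler0 addr0.
Qed.

Lemma av_lie_c1 u : [lie u, av_c1] = 0.
Proof.
have [cl c1 c2 cv] := c1E; rewrite av_lieE; apply: affVirP.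
- rewrite av_loop_br cl cv (bilin0r loop_br_bilin) (bilin0r vir_loop_bilin).
  by rewrite (bilin0l vir_loop_bilin) subr0 addr0 (av_linear0 av_loop_linear).
- by rewrite av_K1_br cl (bilin0r loop_cocycle_bilin) (av_linear0 av_K1_linear).
- by rewrite av_K2_br cv (bilin0r vir_cocycle_bilin) (av_linear0 av_K2_linear).
- by rewrite av_vir_br cv (bilin0r vir_br_bilin) (av_linear0 av_vir_linear).
Qed.

Lemma av_lie_c2 u : [lie u, av_c2] = 0.
Proof.
have [cl c1 c2 cv] := c2E; rewrite av_lieE; apply: affVirP.
- rewrite av_loop_br cl cv (bilin0r loop_br_bilin) (bilin0r vir_loop_bilin).
  by rewrite (bilin0l vir_loop_bilin) subr0 addr0 (av_linear0 av_loop_linear).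
- by rewrite av_K1_br cl (bilin0r loop_cocycle_bilin) (av_linear0 av_K1_linear).
- by rewrite av_K2_br cv (bilin0r vir_cocycle_bilin) (av_linear0 av_K2_linear).
- by rewrite av_vir_br cv (bilin0r vir_br_bilin) (av_linear0 av_vir_linear).
Qed.

Lemma av_lie_d_xt x m n :
  [lie av_d m, av_xt x n] = n%:~R *: av_xt x (m + n).
Proof.
have [dl d1 d2 dv] := dE m; have [yl y1 y2 yv] := xtE x n.
have [zl z1 z2 zv] := xtE x (m + n).
rewrite av_lieE -[RHS]addr0; apply: affVirP.
- rewrite av_loop_br av_loop_linear dl dv yl yv zl vir_loop_mono.
  rewrite (bilin0l loop_br_bilin) (bilin0l vir_loop_bilin).
  rewrite (av_linear0 av_loop_linear) mul1r subr0 add0r.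
  by rewrite lmonoZ addr0.
- rewrite av_K1_br av_K1_linear dl z1 (bilin0l loop_cocycle_bilin).
  by rewrite scaler0 add0r (av_linear0 av_K1_linear).
- rewrite av_K2_br av_K2_linear yv z2 (bilin0r vir_cocycle_bilin).
  by rewrite scaler0 add0r (av_linear0 av_K2_linear).
- rewrite av_vir_br av_vir_linear yv zv (bilin0r vir_br_bilin).
  by rewrite scaler0 add0r (av_linear0 av_vir_linear).
Qed.

Lemma av_lie_d_d m n : [lie av_d m, av_d n] =
  (n - m)%:~R *: av_d (m + n)
  + (if m + n == 0 then (m ^+ 3 - m)%:~R / 12%:R else 0) *: av_c2.
Proof.
have [xl x1 x2 xv] := dE m; have [yl y1 y2 yv] := dE n.
have [zl z1 z2 zv] := dE (m + n); have [cl c1 c2 cv] := c2E.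
rewrite addrC av_lieE; apply: affVirP.
- rewrite av_loop_br av_loop_linear xl yl cl (bilin0l loop_br_bilin).
  rewrite !(bilin0r vir_loop_bilin) scaler0 subr0 !add0r.
  by rewrite -[_ *: av_d _]addr0 av_loop_linear zl (av_linear0 av_loop_linear) scaler0 addr0.
- rewrite av_K1_br av_K1_linear xl c1 (bilin0l loop_cocycle_bilin) scaler0 add0r.
  by rewrite -[_ *: av_d _]addr0 av_K1_linear z1 (av_linear0 av_K1_linear) scaler0 addr0.
- rewrite av_K2_br av_K2_linear xv yv c2 vir_cocycle_mono.
  rewrite -[_ *: av_d _]addr0 av_K2_linear z2 (av_linear0 av_K2_linear).
  by rewrite scaler0 !addr0 regE !mul1r mulr1.
- rewrite av_vir_br av_vir_linear xv yv cv vir_br_mono scaler0 add0r.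
  rewrite -[_ *: av_d _]addr0 av_vir_linear zv (av_linear0 av_vir_linear).
  by rewrite addr0 -lmonoZ regE !mul1r mulr1.
Qed.

#[local] Transparent av_loop av_K1 av_K2 av_vir av_xt av_d av_c1 av_c2.

Lemma affVir_ind (P : affVir -> Prop) :
  (forall x m, P (av_xt x m)) -> P av_c1 -> P av_c2 ->
  (forall m, P (av_d m)) ->
  (forall a u v, P u -> P v -> P (a *: u + v)) -> forall u, P u.
Proof.
move=> Px P1 P2 Pd PL.
have P0 : P 0 by rewrite -(addNr av_c1) -scaleN1r; apply: PL.
have PD u v : P u -> P v -> P (u + v) by rewrite -{2}[u]scale1r; apply: PL.
have PZ a u : P u -> P (a *: u) by rewrite -[_ *: _]addr0 => Pu; apply: PL.
have Pl f : P (f, 0, 0, 0).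
  elim/laurent_ind: f => [m x|f h Pf Ph]; first exact: Px.
  have -> : ((f + h, 0, 0, 0) : affVir) = ((f, 0, 0, 0) : affVir) + (h, 0, 0, 0).
    by apply: affVirP; do ?[by []]; exact: (esym (addr0 _)).
  exact: PD.
have Pv p : P (0, 0, 0, p).
  elim/laurent_ind: p => [m x|f h Pf Ph].
    have -> : ((0, 0, 0, lmono m x) : affVir) = x *: av_d m; last exact: PZ.
    apply: affVirP; [exact/esym/scaler0..|].
    by rewrite -[RHS]/(x *: lmono m (1 : K^o)) -lmonoZ regE mulr1.
  have -> : ((0, 0, 0, f + h) : affVir) = ((0, 0, 0, f) : affVir) + (0, 0, 0, h).
    by apply: affVirP; do ?[by []]; exact: (esym (addr0 _)).
  exact: PD.
move=> [[[f a] b] p].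
have -> : ((f, a, b, p) : affVir) =
    ((f, 0, 0, 0) : affVir) + (a *: av_c1 + (b *: av_c2 + (0, 0, 0, p))).
  apply: affVirP.
  - by rewrite -[RHS]/(f + (a *: 0 + (b *: 0 + 0))) !scaler0 !addr0.
  - by rewrite -[RHS]/(0 + (a * 1 + (b *: (0 : K^o) + 0))) scaler0 !addr0 add0r mulr1.
  - by rewrite -[RHS]/(0 + (a *: (0 : K^o) + (b * 1 + 0))) scaler0 addr0 !add0r mulr1.
  - by rewrite -[RHS]/(0 + (a *: 0 + (b *: 0 + p))) !scaler0 !add0r.
apply: (PD); first exact: Pl.
by apply: (PD); [exact: PZ | apply: PD; [exact: PZ | exact: Pv]].
Qed.

Definition gtilde_pred : {pred affVir} :=
  fun u => (av_K2 u == 0) && (av_vir u == 0).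

Lemma gtilde_closed : submod_closed gtilde_pred.
Proof.
split=> [|a u v]; first by apply/andP.
move=> /andP[/eqP u2 /eqP uv] /andP[/eqP v2 /eqP vv]; apply/andP; split.
  by rewrite av_K2_linear u2 v2 scaler0 addr0.
by rewrite av_vir_linear uv vv scaler0 addr0.
Qed.

HB.instance Definition _ := GRing.isSubmodClosed.Build K affVir gtilde_pred
  (GRing.submod_closed_semi gtilde_closed).

Lemma gtilde_ideal u v : v \in gtilde_pred -> [lie u, v] \in gtilde_pred.
Proof.
move=> /andP[/eqP v2 /eqP vv]; apply/andP; rewrite av_lieE; split; apply/eqP.
  by rewrite av_K2_br vv (bilin0r vir_cocycle_bilin).
by rewrite av_vir_br vv (bilin0r vir_br_bilin).
Qed.

Record gtilde := Gtilde { gtilde_val :> affVir; _ : gtilde_val \in gtilde_pred }.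

HB.instance Definition _ := [isSub for gtilde_val].
HB.instance Definition _ := [Choice of gtilde by <:].
HB.instance Definition _ := [SubChoice_isSubLmodule of gtilde by <:].

Definition gtilde_act u (v : gtilde) : gtilde :=
  Gtilde (gtilde_ideal u (valP v)).

Fact gtilde_act_linearl (s : gtilde) : linear (gtilde_act^~ s).
Proof.
move=> a u w; apply: val_inj; rewrite linearP.
exact: (lieb_linearl (val s)).
Qed.

Fact gtilde_act_linearr u : linear (gtilde_act u).
Proof.
move=> a s t; apply: val_inj; rewrite [RHS]linearP.
rewrite -[LHS]/([lie u, val (a *: s + t)]).
by rewrite (linearP (val : gtilde -> affVir)); exact: lieb_linearr.
Qed.

Fact gtilde_act_lieb u w (s : gtilde) : gtilde_act [lie u, w] s
  = gtilde_act u (gtilde_act w s) - gtilde_act w (gtilde_act u s).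
Proof.
apply: val_inj; rewrite linearB; exact: (lieb_ad u w (val s)).
Qed.

HB.instance Definition _ := Lmodule_isLieModule.Build K affVir gtilde
  gtilde_act_linearl gtilde_act_linearr gtilde_act_lieb.

End AffineVirasoro.

(* Main.v *)
Require Import Defs.
From HB Require Import structures.
From mathcomp Require Import all_boot all_order all_algebra.
From mathcomp Require Import complex ring zify.
From mathcomp Require Import boolp classical_sets reals.

(** Write L for the affine-Virasoro algebra of g.

    Facts on g.  A simple Lie algebra has no centre and is spanned by brackets,
    because the centre and the span of the brackets are ideals.  Its Killing
    form is nonzero (Cartan's criterion): let [x] act on [g] by [ad x], and let
    [f] be the linear map that multiplies the generalised eigenspace of [ad x]
    at [a] by the complex conjugate of [a].  Conjugation is additive and brackets
    add generalised eigenvalues, so [f] is a derivation.  If the Killing form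
    vanished, the trace of [ad x] composed with any derivation would be zero,
    as [x] is a sum of brackets; but for [f] this trace is the sum of
    the squared moduli of the eigenvalues.  Hence every [ad x] would be nilpotent,
    and Engel's theorem would give a nonzero central element
    ([ad_nilpotent_of_trace], [engel], [killing_neq0]).  The radical of the form
    being an ideal, the form is nondegenerate, and then each derivation [d] of [g]
    is inner: the functional sending [x] to the trace of [d] composed with [ad x]
    is represented by an element that implements [d] ([simple_der_inner]).

    Derivations of L.  The element d_0 acts on the degree-n part of L by n.
    Subtracting an inner derivation removes the components of [D d_0] of nonzero
    degree.  Comparing [D [d_0, u]] with [n (D u)] then shows that [D] preserves
    the degree and that [D d_0] is central ([der_homogeneous]).  Modulo the centre
    one has D(x t^m) = psi_m(x) t^m and D(d_m) = phi_m t^m + c_m d_m.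
    The Witt relations force c_m = m c_1 ([offdiag_additive]), and the brackets
    [[d_m, x t^n]] force phi_m = 0 and psi_m(x) = psi_0(x) + m c_1 x, where
    psi_0 is a derivation of g, hence equal to [[lie -, z]].  So [D] agrees modulo
    the centre with the inner derivation of z t^0 - c_1 d_0; and a derivation
    with central values kills all brackets, which span L ([der_central0]).

    A derivation into the ideal [gtilde] is in particular a derivation of L,
    so it is implemented by some [v]; the brackets of the d_m with [v] having no
    Virasoro part, [v] lies in [gtilde] up to a multiple of the central
    element K_2, which can be discarded ([gtilde_adjoint_inner]). *)

Set Implicit Arguments.
Unset Strict Implicit.
Unset Printing Implicit Defensive.

Import Order.TTheory GRing.Theory Num.Theory passmx.
Local Open Scope ring_scope.

(** * Simple Lie algebras: centre and perfectness *)

Section LieBilinear.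
Variables (K : fieldType) (L : lieAlgType K).
Implicit Types x y z : L.

Lemma liebZr a x y : [lie x, a *: y] = a *: [lie x, y].
Proof. exact: linearZ. Qed.

Lemma lieb0r x : [lie x, 0] = 0.
Proof. exact: linear0. Qed.

Lemma liebBr x y z : [lie x, y - z] = [lie x, y] - [lie x, z].
Proof. exact: linearB. Qed.

End LieBilinear.

Section SimpleLie.
Variables (K : fieldType) (g : finLieAlgType K).
Hypothesis gS : lie_simple g.
Implicit Types x y z : g.

(** The line through a central element is an ideal. *)
Lemma simple_centerless z : (forall x, [lie x, z] = 0) -> z = 0.
Proof.
move=> zC; have [[x [y xy]] /(_ <[z]>%VS) []] := gS.
- by move=> u _ /vlineP[a ->]; rewrite linearZ /= zC scaler0 mem0v.
- by move=> z0; apply/eqP; rewrite -memv0 -z0 memv_line.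
- move=> zf; have /vlineP[a ya] : y \in <[z]>%VS by rewrite zf memvf.
  by case: xy; rewrite ya linearZ /= zC scaler0.
Qed.

(** The span of the brackets is a nonzero ideal.  Perfectness is phrased as the
    vanishing of linear maps that kill brackets, for maps to spaces of any
    dimension, as this is how it is applied. *)
Lemma simple_perfect (W : lmodType K) (F : g -> W) :
  linear F -> (forall x y, F [lie x, y] = 0) -> forall z, F z = 0.
Proof.
move=> Fl F0; pose e := vbasis {:g}.
pose X := [seq [lie x, y] | x <- e, y <- e].
have memX x y : [lie x, y] \in <<X>>%VS.
  rewrite (coord_vbasis (memvf x)) (coord_vbasis (memvf y)) linear_sum /=.
  apply: rpred_sum => j _; rewrite linearZ /=; apply: rpredZ.
  rewrite liebC linear_sum /= rpredN; apply: rpred_sum => i _.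
  rewrite linearZ /=; apply: rpredZ.
  apply: memv_span; apply/allpairsP.
  by exists (e`_j, e`_i); rewrite !mem_nth ?size_tuple.
have FX : <<X>>%VS = fullv.
  have [[x [y xy]] /(_ <<X>>%VS) []] := gS => //.
  by move=> X0; move: (memX x y); rewrite X0 memv0 => /eqP.
pose FL := GRing.isLinear.Build K g W _ F Fl.
pose f : {linear g -> W} := HB.pack F FL.
move=> z; have : z \in <<in_tuple X>>%VS by rewrite FX memvf.
move=> /coord_span ->; rewrite -[F]/(f : g -> W) linear_sum big1 // => i _.
rewrite linearZ /=.
have /allpairsP[[x y] [_ _ ->]] := mem_nth 0 (ltn_ord i : (i < size X)%N).
by rewrite F0 scaler0.
Qed.

End SimpleLie.

(** * Engel's theorem *)

Section Engel.
Variables (K : fieldType) (g : finLieAlgType K).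
Hypothesis ad_nil : forall x v : g, exists k, iter k (lieb x) v = 0.
Implicit Types x y z : g.
Implicit Types k U W : {vspace g}.

Definition lie_stable k U := forall x u, x \in k -> u \in U -> [lie x, u] \in U.

(** The statement of Engel's theorem for the action of the subalgebra [k] on the
    subquotients W / U of [g]; speaking of pairs U <= W avoids quotient spaces and
    gives a statement that can be enlarged one dimension at a time. *)
Definition engel_subalgebra k := lie_stable k k /\
  forall U W, lie_stable k U -> lie_stable k W -> (U <= W)%VS -> ~~ (W <= U)%VS ->
  exists2 w, w \in W & w \notin U /\ forall x, x \in k -> [lie x, w] \in U.

(** Applied to the pair k <= g, the hypothesis gives an [x] outside [k] that
    normalises [k], so that k + <x> is a subalgebra.  For a pair U <= W, the vectors
    of W sent into U by [k] form an [x]-stable space; as [ad x] is nilpotent,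
    the last iterate of [ad x] outside U is killed modulo U by both. *)
Lemma engel_extend k : engel_subalgebra k -> k != fullv ->
  exists2 k', engel_subalgebra k' & (\dim k < \dim k')%N.
Proof.
move=> [kk kE] kNf.
have kf : lie_stable k fullv by move=> *; exact: memvf.
have Nfk : ~~ (fullv <= k)%VS by rewrite eqEsubv subvf /= in kNf.
have [x _ [xNk kx]] := kE k fullv kk kf (subvf _) Nfk.
exists (k + <[x]>)%VS; last first.
  rewrite ltn_neqAle dimvS ?addvSl // andbT; apply: contra xNk => /eqP dk.
  have /eqP -> : k == (k + <[x]>)%VS by rewrite eqEdim addvSl dk leqnn.
  by rewrite (subvP (addvSr _ _)) ?memv_line.
split=> [u v|].
  move=> /memv_addP[u1 u1k [_ /vlineP[a ->] ->]] /memv_addP[v1 v1k [_ /vlineP[b ->] ->]].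
  rewrite (subvP (addvSl _ _)) // liebDl !liebDr !liebZl !linearZ /= !lieb_alt !scaler0 addr0.
  have kxC : [lie x, v1] \in k by rewrite liebC rpredN kx.
  by rewrite rpredD ?rpredD ?rpredZ //; [apply: kk | apply: kx].
move=> U W kxU kxW UW NWU.
have kle : {subset k <= (k + <[x]>)%VS} by apply/subvP; exact: addvSl.
have xk : x \in (k + <[x]>)%VS by rewrite (subvP (addvSr _ _)) ?memv_line.
have [w wW [wNU kwU]] : exists2 w, w \in W &
    w \notin U /\ forall x, x \in k -> [lie x, w] \in U.
  by apply: kE => // y u yk; [apply: kxU | apply: kxW]; apply: kle.
have [n nU] : exists n, iter n (lieb x) w \in U.
  by have [n n0] := ad_nil x w; exists n; rewrite n0 mem0v.
elim: n => [|n IHn] in w wW wNU kwU nU *; first by rewrite nU in wNU.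
have [xwU|xwNU] := boolP ([lie x, w] \in U).
  exists w => //; split=> // _ /memv_addP[y yk [_ /vlineP[a ->] ->]].
  by rewrite liebDl liebZl rpredD ?rpredZ //; exact: kwU.
apply: IHn xwNU _ _; [exact: kxW| |by rewrite -iterSr].
move=> y yk; have -> : [lie y, [lie x, w]] = [lie [lie y, x], w] + [lie x, [lie y, w]].
  by rewrite lieb_ad subrK.
by apply: rpredD; [apply/kwU/kx | apply/kxU/kwU].
Qed.

(** Subalgebras are enlarged by [engel_extend] until they reach [g]; then take
    the pair 0 <= g. *)
Lemma engel : (exists x : g, x != 0) ->
  exists2 z : g, z != 0 & forall x, [lie x, z] = 0.
Proof.
move=> [x0 x0N].
have H n : exists2 k, engel_subalgebra k & (k == fullv) || (n <= \dim k)%N.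
  elim: n => [|n [k kE /orP[kf|nk]]].
  - exists 0%VS; last by rewrite leq0n orbT.
    split=> [x u|U W _ _ UW NWU]; first by rewrite !memv0 => /eqP-> _; rewrite lieb0l.
    have [w wW wU] : exists2 w, w \in W & w \notin U by apply/subvPn.
    by exists w => //; split=> // x; rewrite memv0 => /eqP ->; rewrite lieb0l mem0v.
  - by exists k => //; rewrite kf.
  - have [kf|kNf] := boolP (k == fullv); first by exists k => //; rewrite kf.
    have [k' k'E lt] := engel_extend kE kNf.
    by exists k' => //; rewrite (leq_ltn_trans nk lt) orbT.
have [k [_ kE] kf] := H (\dim {:g}).+1.
have {kf} kf : k = fullv by case/orP: kf => [/eqP//|]; rewrite ltnNge dimvS ?subvf.
have [||||w _ [w0 ww]] := kE 0%VS fullv.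
- by move=> x u _; rewrite !memv0 => /eqP ->; rewrite linear0.
- by move=> *; exact: memvf.
- exact: sub0v.
- by apply/subvPn; exists x0; rewrite ?memvf ?memv0.
exists w; first by rewrite -memv0.
by move=> x; apply/eqP; rewrite -memv0 ww // kf memvf.
Qed.

End Engel.

(** * Primary decomposition *)

(** Chinese remainder idempotents: modulo the product of the [p b], the [e a]
    add up to 1 and [e a] is killed by [p a]. *)
Lemma partition_of_unity (F : fieldType) (s : seq F) (p : F -> {poly F}) :
  uniq s -> {in s &, forall a b, a != b -> coprimep (p a) (p b)} ->
  exists e : F -> {poly F}, \prod_(b <- s) p b %| 1 - \sum_(a <- s) e a /\
    {in s, forall a, \prod_(b <- s) p b %| p a * e a}.
Proof.
elim: s => [_ _|b s IHs /= /andP[bNs us] cop].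
  by exists (fun=> 0); rewrite !big_nil dvd1p.
have [|e [e1 ep]] := IHs us.
  by move=> a c sa sc; apply: cop; rewrite inE ?sa ?sc orbT.
have cb : coprimep (p b) (\prod_(a <- s) p a).
  rewrite big_seq; elim/big_ind: _ => [|q r cq cr|a sa]; first exact: coprimep1.
    by rewrite coprimepMr cq.
  by apply: cop; rewrite ?inE ?eqxx ?sa ?orbT //; apply: contraNneq bNs => ->.
have [u [v uv]] : exists u v : {poly F}, u * p b + v * \prod_(a <- s) p a = 1.
  by have /Bezout_eq1_coprimepP[[u v] /= uv] := cb; exists u, v.
exists (fun a => if a == b then v * \prod_(a <- s) p a else u * p b * e a).
have eb a : a \in s -> (a == b) = false.
  by move=> sa; apply: contraNF bNs => /eqP <-.
split.
  rewrite !big_cons eqxx.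
  rewrite [X in 1 - (_ + X)](eq_big_seq (fun a => u * p b * e a)); last first.
    by move=> a /eb /= ->.
  rewrite -mulr_sumr -[X in _ %| X - _]uv opprD addrA addrK -[X in _ %| X - _]mulr1 -mulrBr.
  by rewrite -mulrA dvdp_mull // dvdp_mul.
move=> a; rewrite inE big_cons => /orP[/eqP ->|sa].
  by rewrite eqxx dvdp_mul ?dvdp_mull.
by rewrite eb // mulrCA -mulrA dvdp_mull // dvdp_mul ?ep.
Qed.

(** Membership in the generalised eigenspace at [a]; the exponent is left free so
    that no dimension is involved. *)
Definition gen_eigen (F : fieldType) (V : lmodType F) (f : V -> V) (a : F) (v : V) :=
  exists k, iter k (fun w => f w - a *: w) v = 0.

Section PrimaryProjections.
Variable F : closedFieldType.

(** The projections are polynomials in [M]: a partition of unity for the primary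
    factors of the characteristic polynomial, which kills [M]. *)
Lemma mx_primary_projections n (M : 'M[F]_n) :
  exists (s : seq F) (P : F -> 'M[F]_n),
  [/\ uniq s, \sum_(a <- s) P a = 1%:M, forall a, P a *m M = M *m P a &
      {in s, forall a (v : 'rV_n), gen_eigen (mulmxr M) a (v *m P a)}].
Proof.
case: n M => [|n] M.
  exists [::], (fun=> 0); split=> // [|a]; last by rewrite mul0mx mulmx0.
  by rewrite big_nil; apply/matrixP => -[].
have [r rE] := closed_field_poly_normal (char_poly M).
rewrite (monicP (char_poly_monic M)) scale1r in rE.
pose p a : {poly F} := ('X - a%:P) ^+ count_mem a r.
have [a b _ _ ab|e [e1 ep]] := @partition_of_unity F (undup r) p (undup_uniq r).
  by rewrite coprimep_expr ?coprimep_expl // coprimep_XsubC root_XsubC eq_sym.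
exists (undup r), (fun a => horner_mx M (e a)); split; first exact: undup_uniq.
- apply/eqP; rewrite -rmorph_sum eq_sym -subr_eq0 -[1%:M](rmorph1 (horner_mx M)) -rmorphB /=.
  have /dvdpP[q ->] : char_poly M %| 1 - \sum_(i <- undup r) e i.
    by rewrite rE -(prodr_undup_exp_count r xpredT).
  by rewrite rmorphM /= Cayley_Hamilton mulr0.
- by move=> a; apply/comm_mx_sym/comm_mx_horner/comm_mx_refl.
move=> a ar v; exists (count_mem a r).
have E k w : iter k (fun w => mulmxr M w - a *: w) w = w *m (M - a%:M) ^+ k.
  elim: k => [|k IHk] /=; first by rewrite mulmx1.
  by rewrite IHk exprSr -mulmxE mulmxA mulmxBr mul_mx_scalar.
have : char_poly M %| p a * e a.
  by rewrite rE -(prodr_undup_exp_count r xpredT) ep.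
case/dvdpP => q qE; rewrite E -mulmxA mulmxE.
have -> : (M - a%:M) ^+ count_mem a r = horner_mx M (p a).
  by rewrite rmorphXn rmorphB /= horner_mx_X horner_mx_C.
by rewrite -rmorphM mulrC qE rmorphM /= Cayley_Hamilton mulr0 mulmx0.
Qed.

End PrimaryProjections.

Section GenEigen.
Variables (F : fieldType) (V : lmodType F) (f : {linear V -> V}).
Implicit Types (a b : F) (v w : V).

Let shift a w := f w - a *: w.

Lemma gen_eigen_comm (h : V -> V) a v : linear h -> (forall w, h (f w) = f (h w)) ->
  gen_eigen f a v -> gen_eigen f a (h v).
Proof.
move=> hl hf [k k0]; exists k.
have hB u w : h (u - a *: w) = h u - a *: h w by rewrite addrC -scaleNr hl addrC scaleNr.
have h0 : h 0 = 0 by have := hl (-1) 0 0; rewrite scaler0 addr0 scaleN1r addNr.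
rewrite -[RHS]h0 -k0; elim: k {k0} => //= k ->.
by rewrite hB hf.
Qed.

(** Otherwise the last nonzero iterate of [f - a] on [v] is an eigenvector for [a]
    that still lies in the generalised eigenspace at [b], where [f - b] acts on it
    as the nonzero scalar [a - b]. *)
Lemma gen_eigen_inj a b v : gen_eigen f a v -> gen_eigen f b v -> a != b -> v = 0.
Proof.
move=> [k k0] vb ab; elim: k v k0 vb => // k IHk v k0 vb.
have av : f v = a *: v.
  apply/eqP; rewrite -subr_eq0; apply/eqP; apply: IHk; first by rewrite -iterSr.
  apply: (@gen_eigen_comm (shift a)) vb => [c u w|w]; rewrite /shift.
    rewrite linearP /= scalerDr scalerBr !scalerA [a * c]mulrC opprD.
    by rewrite addrACA.
  by rewrite linearB [f (a *: w)]linearZ.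
have [l] := vb.
have -> : iter l (fun w => f w - b *: w) v = (a - b) ^+ l *: v.
  elim: l => [|l /= ->]; first by rewrite scale1r.
  by rewrite linearZ /= av !scalerA -scalerBl [_ * a]mulrC -mulrBl -exprS.
by move/eqP; rewrite scaler_eq0 expf_eq0 subr_eq0 (negPf ab) andbF => /eqP.
Qed.

End GenEigen.

Section LfunPrimary.
Variables (C : closedFieldType) (V : vectType C).
Implicit Types f p : 'End(V).

Let e := vbasis {:V}.
Let eB : basis_of {:V} e := vbasisP _.

Lemma lfun_primary_projections f :
  exists (s : seq C) (P : C -> 'End(V)),
  [/\ uniq s, forall v, \sum_(a <- s) P a v = v, forall a v, P a (f v) = f (P a v) &
      {in s, forall a v, gen_eigen f a (P a v)}].
Proof.
have [s [P [us P1 Pf Pg]]] := mx_primary_projections (mxof e e f).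
have toV u v : rVof e u = rVof e v -> u = v.
  by apply: (can_inj (rVofK eB)).
have hE M v : rVof e (hommx e e M v) = rVof e v *m M.
  by rewrite (@rVof_app _ _ _ e e eB) hommxK.
exists s, (fun a => hommx e e (P a)); split=> // [v|a v|a sa v]; try apply: toV.
- rewrite linear_sum /= (eq_bigr (fun a => rVof e v *m P a)) => [|a _].
    by rewrite -mulmx_sumr P1 mulmx1.
  exact: hE.
- by rewrite hE !(@rVof_app _ _ _ e e eB) hommxK // -!mulmxA Pf.
have [k k0] := Pg a sa (rVof e v); exists k; apply: toV; rewrite linear0 -[RHS]k0.
elim: k {k0} => [|k IHk] /=; first by rewrite hE.
by rewrite linearB linearZ /= -IHk (@rVof_app _ _ _ e e eB).
Qed.

End LfunPrimary.

Section LfunTrace.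
Variables (C : closedFieldType) (V : finLieAlgType C).
Implicit Types f p : 'End(V).

Let e := vbasis {:V}.
Let eB : basis_of {:V} e := vbasisP _.

(** All roots of the characteristic polynomial vanish, so it is a power of 'X. *)
Lemma lfun_trace_nilpotent f :
  (forall v, exists k, iter k f v = 0) -> lfun_trace f = 0.
Proof.
move=> fN; rewrite /lfun_trace -/e; set M := mxof e e f.
have ev0 a : root (char_poly M) a -> a = 0.
  rewrite -eigenvalue_root_char => /eigenvalueP[w wM wN0].
  have fw : f (vecof e w) = a *: vecof e w.
    by rewrite (@hom_vecof _ _ _ e e eB) wM linearZ.
  have [k] := fN (vecof e w).
  have -> : iter k f (vecof e w) = a ^+ k *: vecof e w.
    elim: k => [|k /= ->]; first by rewrite scale1r.
    by rewrite linearZ /= fw scalerA -exprSr.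
  move/eqP; rewrite scaler_eq0 expf_eq0 vecof_eq0 // (negPf wN0) orbF.
  by case/andP => _ /eqP.
have [r rE] := closed_field_poly_normal (char_poly M).
rewrite (monicP (char_poly_monic M)) scale1r in rE.
have {}rE : char_poly M = 'X^(size r).
  rewrite rE (eq_big_seq (fun=> 'X)) ?big_const_seq ?count_predT ?iter_mulr_1 //.
  move=> a ar; rewrite [a]ev0 ?subr0 // rE; rewrite root_prod_XsubC //.
have [n0|n0] := posnP (\dim {:V}).
  by rewrite /mxtrace big1 // => i; have := ltn_ord i; rewrite [X in (_ < X)%N -> _]n0.
have := char_poly_trace M n0; have := size_char_poly M.
rewrite rE size_polyXn => -[->].
by rewrite coefXn ltn_eqF ?ltn_predL // => /esym/eqP; rewrite oppr_eq0 => /eqP.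
Qed.

(** The trace of an idempotent is its rank, by its factorisation through its image. *)
Lemma lfun_trace_idempotent p :
  (p \o p = p)%VF -> exists2 r : nat, lfun_trace p = r%:R & (r == 0)%N -> p = 0.
Proof.
move=> pp; rewrite /lfun_trace -/e; set M := mxof e e p.
have MM : M *m M = M by rewrite -(mxof_comp _ _ eB) pp.
exists (\rank M); last first.
  by rewrite mxrank_eq0 mxof_eq0 // => /eqP.
rewrite -{1}(mulmx_base M) mxtrace_mulC.
suff -> : row_base M *m col_base M = 1%:M by rewrite mxtrace1.
apply: (row_free_inj (row_base_free M)); apply: (row_full_inj (col_base_full M)).
move: (col_base M) (row_base M) (mulmx_base M) => A B AB.
by rewrite mul1mx !mulmxA AB -mulmxA AB.
Qed.

End LfunTrace.

(** * Cartan's criterion and derivations of a simple Lie algebra *)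

(** [ad x - (a + b)] acts on brackets by the Leibniz rule from [ad x - a] and
    [ad x - b]. *)
Lemma gen_eigen_lie (F : fieldType) (L : lieAlgType F) (x u v : L) (a b : F) :
  gen_eigen (lieb x) a u -> gen_eigen (lieb x) b v ->
  gen_eigen (lieb x) (a + b) [lie u, v].
Proof.
pose N c w := [lie x, w] - c *: w.
have NN u1 v1 : N (a + b) [lie u1, v1] = [lie N a u1, v1] + [lie u1, N b v1].
  rewrite /N liebDl liebNl liebZl liebBr liebZr lieb_ad scalerDl opprD addrA [RHS]addrA.
  by congr (_ - _); rewrite [RHS]addrAC subrK.
have ND c w1 w2 : N c (w1 + w2) = N c w1 + N c w2.
  by rewrite /N linearD /= scalerDr opprD addrACA.
have iD c n w1 w2 : iter n (N c) (w1 + w2) = iter n (N c) w1 + iter n (N c) w2.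
  by elim: n => //= n ->; rewrite ND.
have N0 c n : iter n (N c) 0 = 0.
  by elim: n => //= n ->; rewrite /N linear0 scaler0 subrr.
move=> [m m0] [n n0]; exists (m + n)%N; rewrite -/(N _).
move eq_s: (m + n)%N => s.
elim: s m n eq_s u v m0 n0 => [|s IHs] [|m] [|n] //; rewrite ?addn0 ?add0n ?addnS ?addSn.
- by move=> _ u v /= -> _; rewrite lieb0l.
- by move=> _ u v /= -> _; rewrite lieb0l; exact: (N0 _ s.+1).
- by move=> _ u v /= _ ->; rewrite linear0; exact: (N0 _ s.+1).
move=> [eq_s] u v; rewrite !iterSr => m0 n0; rewrite NN iD.
rewrite (IHs m n.+1 _ (N a u)) ?addnS ?iterSr // (IHs m.+1 n _ u) ?addSn ?iterSr //.
by rewrite addr0.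
Qed.

Section Cartan.
Variables (C : numClosedFieldType) (g : finLieAlgType C).
Implicit Types x y z u v : g.

(** The derivation [f] that acts as the conjugate of [a] on the generalised
    eigenspace of [ad x] at [a] satisfies tr (ad x f) = sum of |a|^2 dim, so the
    hypothesis leaves 0 as the only eigenvalue. *)
Lemma ad_nilpotent_of_trace x : (forall f : 'End(g),
    (forall u v, f [lie u, v] = [lie f u, v] + [lie u, f v]) ->
    lfun_trace (lie_ad x \o f)%VF = 0) ->
  forall v, exists k, iter k (lieb x) v = 0.
Proof.
move=> tr0; have [s [P [us P1 Pf Pg]]] := lfun_primary_projections (lie_ad x).
have {}Pg a v : a \in s -> gen_eigen (lieb x) a (P a v).
  move=> sa; have [k k0] := Pg a sa v; exists k; rewrite -[RHS]k0.
  by apply: eq_iter => w; rewrite lie_adE.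
have {}Pf a v : P a [lie x, v] = [lie x, P a v] by rewrite -!lie_adE Pf.
have P0 a b v : a \in s -> gen_eigen (lieb x) b v -> a != b -> P a v = 0.
  move=> sa vb; apply: gen_eigen_inj (Pg a v sa) _.
  by apply: gen_eigen_comm vb => [|w]; [exact: linearP | exact: Pf].
have PP a v : a \in s -> P a (P a v) = P a v.
  move=> sa; rewrite -[RHS]P1 (bigD1_seq a) //= big1_seq ?addr0 // => b /andP[ba sb].
  exact: P0 (Pg a v sa) ba.
pose f : 'End(g) := \sum_(a <- s) a^* *: P a.
have fE v : f v = \sum_(a <- s) a^* *: P a v.
  by rewrite /f sum_lfunE; apply: eq_bigr => a _; rewrite lfunE.
have fg c v : gen_eigen (lieb x) c v -> f v = c^* *: v.
  move=> vc; rewrite fE -{2}[v]P1 scaler_sumr; apply: eq_big_seq => a sa.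
  by have [->//|ac] := eqVneq a c; rewrite (P0 a c) // !scaler0.
have fder u v : f [lie u, v] = [lie f u, v] + [lie u, f v].
  have eu : [lie u, v] = \sum_(a <- s) \sum_(b <- s) [lie P a u, P b v].
    rewrite -{1}[u]P1 -{1}[v]P1 liebC linear_sum -sumrN; apply: eq_bigr => a _.
    by rewrite -liebC linear_sum.
  rewrite eu linear_sum [X in _ = X + _](_ : _ =
      \sum_(a <- s) \sum_(b <- s) a^* *: [lie P a u, P b v]).
    rewrite [X in _ = _ + X](_ : _ =
        \sum_(a <- s) \sum_(b <- s) b^* *: [lie P a u, P b v]).
      rewrite -big_split; apply: eq_big_seq => a sa /=.
      rewrite -big_split linear_sum; apply: eq_big_seq => b sb /=.
      by rewrite -scalerDl -rmorphD; apply/fg/gen_eigen_lie; apply: Pg.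
    rewrite -{1}[u]P1 fE liebC linear_sum -sumrN; apply: eq_bigr => a _.
    rewrite -liebC linear_sum; apply: eq_bigr => b _.
    by rewrite linearZ.
  rewrite -{1}[v]P1 fE liebC linear_sum -sumrN; apply: eq_bigr => a _.
  rewrite -liebC linear_sum; apply: eq_bigr => b _.
  by rewrite /= liebZl.
have ltD (r : seq C) (G : C -> 'End(g)) (c : C -> C) :
    lfun_trace (\sum_(a <- r) c a *: G a) = \sum_(a <- r) c a * lfun_trace (G a).
  elim: r => [|a r IHr]; last by rewrite !big_cons lfun_trace_linear IHr.
  rewrite !big_nil; have := lfun_trace_linear (-1) (0 : 'End(g)) 0.
  by rewrite scaler0 addr0 mulN1r addNr.
(* [ad x - a] is nilpotent on the image of [P a] *)
have trP a : a \in s -> lfun_trace (lie_ad x \o P a)%VF = a * lfun_trace (P a).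
  move=> sa; apply/eqP; rewrite -subr_eq0 addrC -mulNr -lfun_trace_linear; apply/eqP.
  apply: lfun_trace_nilpotent => v; set N := (_ + _).
  have NE w : N w = P a ([lie x, w] - a *: w).
    by rewrite !lfunE /= !lfunE /= lie_adE linearB linearZ /= Pf scaleNr addrC.
  have PN w : P a ([lie x, w] - a *: w) = [lie x, P a w] - a *: P a w.
    by rewrite linearB linearZ /= Pf.
  have NP w : N (P a w) = [lie x, P a w] - a *: P a w.
    by rewrite NE PN PP.
  have [k k0] := Pg a v sa; exists k.+1.
  have -> : iter k.+1 N v = N (iter k N (P a v)).
    elim: k {k0} => [|k IHk] /=; last by rewrite -IHk.
    by rewrite NP NE PN.
  have -> : iter k N (P a v) = iter k (fun w => [lie x, w] - a *: w) (P a v).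
    have : exists w, iter k (fun w => [lie x, w] - a *: w) (P a v) = P a w /\
                     iter k N (P a v) = P a w.
      elim: k {k0} => [|k [w [w1 w2]]] /=; first by exists v.
      exists ([lie x, w] - a *: w); rewrite w1 w2 NP.
      by rewrite PN.
    by case=> w [-> ->].
  by rewrite k0 linear0.
have PPv a : a \in s -> (P a \o P a = P a)%VF.
  by move=> sa; apply/lfunP => v; rewrite lfunE /= PP.
have tf0 : \sum_(a <- s) `|a| ^+ 2 * lfun_trace (P a) = 0.
  rewrite -[RHS](tr0 f fder).
  have -> : (lie_ad x \o f)%VF = \sum_(a <- s) a^* *: (lie_ad x \o P a)%VF.
    apply/lfunP => v; rewrite sum_lfunE lfunE /= fE linear_sum.
    apply: eq_bigr => a _; rewrite [RHS]lfunE /= !lie_adE liebZr.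
    by rewrite [in RHS]comp_lfunE lie_adE.
  rewrite ltD; apply: eq_big_seq => a sa.
  by rewrite trP // normCKC mulrA.
(* all terms of the sum are nonnegative *)
have P00 a : a \in s -> a != 0 -> P a = 0.
  move=> sa a0; have [r trr r0] := lfun_trace_idempotent (PPv a sa).
  apply: r0; move/eqP: tf0; rewrite big_seq psumr_eq0 => [/allP/(_ a sa)|b sb].
    by rewrite sa /= trr mulf_eq0 expf_eq0 normr_eq0 (negPf a0) /= pnatr_eq0.
  have [q -> _] := lfun_trace_idempotent (PPv b sb).
  by rewrite mulr_ge0 ?exprn_ge0 ?ler0n.
move=> v; have [s0|s0] := boolP (0 \in s); last first.
  exists 0%N; rewrite /= -[v]P1 big_seq big1 // => a sa.
  by rewrite P00 ?lfunE //=; apply: contraNneq s0 => <-.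
have -> : v = P 0 v.
  rewrite -[LHS]P1 (bigD1_seq 0) //= big1_seq ?addr0 // => a /andP[a0 sa].
  by rewrite P00 // lfunE.
have [k k0] := Pg 0 v s0; exists k; rewrite -[RHS]k0.
by apply: eq_iter => w; rewrite scale0r subr0.
Qed.

Hypothesis gS : lie_simple g.

Let gP := simple_perfect gS.

(** Were the form zero, then tr (ad [u, v] f) = - killing u (f v) would vanish for
    all derivations [f], and every [ad x] would be nilpotent. *)
Lemma killing_neq0 : exists x y, killing x y != 0.
Proof.
apply: contrapT => k0; have {}k0 x y : killing x y = 0.
  by apply: contrapT => /eqP kxy; apply: k0; exists x, y.
have nil x : forall v, exists k, iter k (lieb x) v = 0.
  apply: ad_nilpotent_of_trace => f fd.
  apply: (gP (W := C^o) (F := fun x => lfun_trace (lie_ad x \o f)%VF)) => [a u v|u v].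
    by rewrite lie_ad_linear comp_lfunDl -comp_lfunZl lfun_trace_linear.
  rewrite -[RHS](k0 u (- f v)) /killing lie_ad_lieb comp_lfunDl comp_lfunNl lfun_traceB.
  rewrite -!comp_lfunA [X in _ - X]lfun_traceC -comp_lfunA -lfun_traceB; congr lfun_trace.
  apply/lfunP => w; rewrite !lfunE /= !lfunE /= !lfunE /= !lie_adE.
  by rewrite -liebBr [(f \o _)%VF w]lfunE /= lie_adE fd opprD addrCA subrr addr0 liebNl.
have [z z0 zC] : exists2 z : g, z != 0 & forall x, [lie x, z] = 0.
  apply: engel => //; have [[x [y xy]] _] := gS.
  by exists x; apply/eqP => x0; rewrite x0 lieb0l in xy.
by move/eqP: z0; apply; apply: simple_centerless.
Qed.

Lemma killingNl x y : killing (- x) y = - killing x y.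
Proof.
have k0 : killing 0 y = 0.
  by have := killing_linearl y (-1) 0 0; rewrite scaler0 addr0 mulN1r addNr.
by have := killing_linearl y (-1) x 0; rewrite k0 !addr0 scaleN1r mulN1r.
Qed.

Let kfl x : linear (killing x : g -> C^o).
Proof. exact: killing_linearr. Qed.

(* [kf] and [Kf] present the form as a linear map to the dual space *)
Let kf x : 'Hom(g, C^o) := linfun (HB.pack_for {linear g -> C^o} (killing x : g -> C^o)
   (GRing.isLinear.Build C g C^o _ (killing x : g -> C^o) (kfl x))).

Let kfE x y : kf x y = killing x y.
Proof. by rewrite lfunE. Qed.

Let kf_linear : linear kf.
Proof. by move=> a x y; apply/lfunP => z; rewrite !lfunE /= lfunE /= !kfE killing_linearl. Qed.

Let Kf : 'Hom(g, 'Hom(g, C^o)) := linfun (HB.pack_for {linear g -> 'Hom(g, C^o)} kf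
   (GRing.isLinear.Build C g 'Hom(g, C^o) _ kf kf_linear)).

Let KfE x y : Kf x y = killing x y.
Proof. by rewrite lfunE /= kfE. Qed.

(* the radical is an ideal by invariance of the form *)
Let Kf0 : lker Kf = 0%VS.
Proof.
case: (gS.2 (lker Kf)) => // [x y|kF].
  rewrite !memv_ker => /eqP y0; apply/eqP/lfunP => z.
  by rewrite KfE liebC killingNl killing_invariant -KfE y0 [RHS]lfunE lfunE oppr0.
have [x [y]] := killing_neq0; case/eqP.
have : x \in lker Kf by rewrite kF memvf.
by rewrite memv_ker => /eqP Kx; rewrite -KfE Kx lfunE.
Qed.

Lemma killing_nondegenerate x : (forall y, killing x y = 0) -> x = 0.
Proof.
move=> x0; apply/eqP; rewrite -memv0 -Kf0 memv_ker; apply/eqP/lfunP => y.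
by rewrite KfE x0 lfunE.
Qed.

Lemma killing_represents (h : g -> C) : linear_for *%R h ->
  exists z, forall x, h x = killing z x.
Proof.
move=> hl; pose H : 'Hom(g, C^o) := linfun (HB.pack_for {linear g -> C^o} (h : g -> C^o)
   (GRing.isLinear.Build C g C^o _ (h : g -> C^o) hl)).
have : H \in limg Kf.
  suff -> : limg Kf = fullv by rewrite memvf.
  apply/eqP; rewrite eqEdim subvf /= limg_dim_eq; last by rewrite Kf0 capv0.
  by rewrite !dimvf /dim /= muln1.
case/memv_imgP => z _ Hz; exists z => x.
by rewrite -KfE -Hz lfunE.
Qed.

(** Let [z] represent the functional tr (d ad x).  The derivation E = d - ad z
    satisfies tr (E ad x) = 0 for all [x], and killing (E x) y = tr (E ad [x, y]),
    so E is zero by nondegeneracy. *)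
Lemma simple_der_inner (d : g -> g) : linear d ->
  (forall x y, d [lie x, y] = [lie x, d y] - [lie y, d x]) ->
  exists z, forall x, d x = [lie x, z].
Proof.
move=> dl dd; pose D : 'End(g) := linfun (HB.pack_for {linear g -> g} d
   (GRing.isLinear.Build C g g _ d dl)).
have [|z zE] := @killing_represents (fun x => lfun_trace (D \o lie_ad x)%VF).
  by move=> a x y; rewrite lie_ad_linear comp_lfunDr -comp_lfunZr lfun_trace_linear.
exists (- z) => x; apply/eqP; rewrite linearN -liebC -subr_eq0; apply/eqP.
pose E := D - lie_ad z.
have EE u : E u = d u - [lie z, u] by rewrite !lfunE /= !lfunE /= lie_adE.
rewrite -EE; apply: killing_nondegenerate => y.
have tE u : lfun_trace (E \o lie_ad u)%VF = 0.
  by rewrite comp_lfunDl comp_lfunNl lfun_traceB zE subrr.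
have Ed u w : E [lie u, w] = [lie E u, w] + [lie u, E w].
  rewrite !EE dd liebDl liebNl liebBr lieb_ad [in LHS](liebC w) opprK.
  by rewrite opprB [RHS]addrACA [X in _ = _ + X]addrAC subrr add0r [X in X - _ = _]addrC.
have adE : lie_ad (E x) = (E \o lie_ad x)%VF - (lie_ad x \o E)%VF.
  apply/lfunP => w; rewrite lfunE [RHS]lfunE /= [X in _ = _ + X]lfunE /= !comp_lfunE.
  by rewrite !lie_adE Ed addrK.
rewrite -[RHS](tE [lie x, y]) /killing lie_ad_lieb adE comp_lfunDr comp_lfunNr.
rewrite comp_lfunDl comp_lfunNl !lfun_traceB -!comp_lfunA; congr (_ - _).
by rewrite [LHS]lfun_traceC -comp_lfunA.
Qed.

End Cartan.

(** * The affine-Virasoro algebra in coordinates *)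

Lemma linear_fun0 (K : fieldType) (V W : lmodType K) (F : V -> W) : linear F -> F 0 = 0.
Proof. by move=> Fl; have := Fl (-1) 0 0; rewrite scaler0 addr0 scaleN1r addNr. Qed.

Lemma linear_funD (K : fieldType) (V W : lmodType K) (F : V -> W) u v :
  linear F -> F (u + v) = F u + F v.
Proof. by move=> Fl; have := Fl 1 u v; rewrite !scale1r. Qed.

Lemma linear_funZ (K : fieldType) (V W : lmodType K) (F : V -> W) a u :
  linear F -> F (a *: u) = a *: F u.
Proof. by move=> Fl; have := Fl a u 0; rewrite (linear_fun0 Fl) !addr0. Qed.

Lemma linear_funB (K : fieldType) (V W : lmodType K) (F : V -> W) u v :
  linear F -> F (u - v) = F u - F v.
Proof. by move=> Fl; rewrite linear_funD // -scaleN1r linear_funZ // scaleN1r. Qed.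

Lemma scaler_eq0r (K : fieldType) (V : lmodType K) (a : K) (u : V) :
  a != 0 -> a *: u = 0 -> u = 0.
Proof. by move=> a0 /eqP; rewrite scaler_eq0 (negPf a0) => /eqP. Qed.

(** The coefficients of D(d_m) on d_m satisfy the hypothesis when [D] is a
    derivation.  Additivity is known at pairs of distinct integers only; c 2 = 2 c 1
    is recovered from c 4 computed both as c 1 + c 3 and, through 2 = 4 - 2, as
    2 c 2. *)
Lemma offdiag_additive (K : numFieldType) (c : int -> K) :
  (forall m n : int, (n - m)%:~R * c (m + n) = (n - m)%:~R * (c m + c n)) ->
  forall m, c m = m%:~R * c 1.
Proof.
move=> cE.
have cD m n : m != n -> c (m + n) = c m + c n.
  move=> mn; apply: (mulfI _ (cE m n)).
  by rewrite intr_eq0 subr_eq0 eq_sym.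
have c0 : c 0 = 0 by have := cD 0 1 isT; rewrite add0r -{1}[c 1]add0r => /addIr/esym.
have cN n : n != 0 -> c (- n) = - c n.
  move=> n0; apply/eqP; rewrite -addr_eq0 -cD ?addNr ?c0 //.
  by lia.
have c2 : c 2 = 2 * c 1.
  have := cD 1 2 isT; rewrite -[1 + 2]/(3 : int) => c3E.
  have := cD 4 (-2) isT; rewrite cN // -[4 - 2]/(2 : int) => c2E'.
  have := cD 1 3 isT; rewrite -[1 + 3]/(4 : int) => c4E.
  by rewrite c2E' c4E c3E addrA addrK mulr_natl.
have cS n : c n.+1%:Z = n.+1%:~R * c 1.
  elim: n => [|[|n] IHn]; first by rewrite mul1r.
    by rewrite c2.
  have -> : n.+3%:Z = n.+2%:Z + 1 by lia.
  by rewrite cD // IHn [in RHS]intrD [RHS]mulrDl mul1r.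
by case=> [[|n]|n]; rewrite ?mul0r ?NegzE // cN // cS intrN mulNr.
Qed.

Section AffVirCoef.
Variables (K : numFieldType) (g : finLieAlgType K).
Local Notation L := (affVir g).
Implicit Types (u v w : L) (x y z : g) (m n k : int) (a b : K).

Definition loop_coef u k : g := lcoef (av_loop u) k.
Definition vir_coef u k : K := lcoef (av_vir u) k.

Lemma loop_coef_linear k : linear (loop_coef^~ k).
Proof. by move=> a u v; rewrite /loop_coef av_loop_linear lcoef_linear. Qed.

Lemma vir_coef_linear k : linear (vir_coef^~ k : L -> K^o).
Proof. by move=> a u v; rewrite /vir_coef av_vir_linear lcoef_linear. Qed.

Lemma loop_coef0 k : loop_coef 0 k = 0.
Proof. exact: linear_fun0 (loop_coef_linear k). Qed.

Lemma loop_coefD u v k : loop_coef (u + v) k = loop_coef u k + loop_coef v k.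
Proof. exact: linear_funD (loop_coef_linear k). Qed.

Lemma loop_coefB u v k : loop_coef (u - v) k = loop_coef u k - loop_coef v k.
Proof. exact: linear_funB (loop_coef_linear k). Qed.

Lemma loop_coefZ a u k : loop_coef (a *: u) k = a *: loop_coef u k.
Proof. exact: linear_funZ (loop_coef_linear k). Qed.

Lemma vir_coef0 k : vir_coef 0 k = 0.
Proof. exact: linear_fun0 (vir_coef_linear k). Qed.

Lemma vir_coefD u v k : vir_coef (u + v) k = vir_coef u k + vir_coef v k.
Proof. exact: linear_funD (vir_coef_linear k). Qed.

Lemma vir_coefB u v k : vir_coef (u - v) k = vir_coef u k - vir_coef v k.
Proof. exact: linear_funB (vir_coef_linear k). Qed.

Lemma vir_coefZ a u k : vir_coef (a *: u) k = a * vir_coef u k.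
Proof. exact: linear_funZ (vir_coef_linear k). Qed.

Lemma affVir_eq u v : loop_coef u =1 loop_coef v -> vir_coef u =1 vir_coef v ->
  av_K1 u = av_K1 v -> av_K2 u = av_K2 v -> u = v.
Proof. by move=> l r k1 k2; apply: affVirP => //; apply/laurentP. Qed.

Lemma loop_coef_xt x m k : loop_coef (av_xt x m) k = x *+ (m == k).
Proof. exact: lcoef_mono. Qed.

Lemma vir_coef_xt x m k : vir_coef (av_xt x m) k = 0.
Proof. exact: (linear_fun0 (lcoef_linear (K := K) (V := K^o) k)). Qed.

Lemma loop_coef_d m k : loop_coef (av_d g m) k = 0.
Proof. exact: (linear_fun0 (lcoef_linear k)). Qed.

Lemma vir_coef_d m k : vir_coef (av_d g m) k = (m == k)%:R.
Proof. exact: (lcoef_mono m k (1 : K^o)). Qed.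

Lemma loop_coef_c1 k : loop_coef (av_c1 g) k = 0.
Proof. exact: (linear_fun0 (lcoef_linear k)). Qed.
Lemma vir_coef_c1 k : vir_coef (av_c1 g) k = 0.
Proof. exact: (linear_fun0 (lcoef_linear (K := K) (V := K^o) k)). Qed.
Lemma loop_coef_c2 k : loop_coef (av_c2 g) k = 0.
Proof. exact: (linear_fun0 (lcoef_linear k)). Qed.
Lemma vir_coef_c2 k : vir_coef (av_c2 g) k = 0.
Proof. exact: (linear_fun0 (lcoef_linear (K := K) (V := K^o) k)). Qed.

Lemma av_xt_linear m : linear (fun x => av_xt x m : L).
Proof.
move=> a x y; apply: affVir_eq => [k|k||].
- by rewrite loop_coef_linear !loop_coef_xt mulrnDl scalerMnr.
- by rewrite vir_coef_linear !vir_coef_xt scaler0 addr0.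
- by rewrite av_K1_linear scaler0 addr0.
- by rewrite av_K2_linear scaler0 addr0.
Qed.

Lemma loop_coef_lie_d m u k :
  loop_coef [lie av_d g m, u] k = (k - m)%:~R *: loop_coef u (k - m).
Proof.
elim/affVir_ind: u => [x n|||n|a u v Hu Hv].
- rewrite av_lie_d_xt loop_coefZ !loop_coef_xt.
  rewrite -[_ == k - m](inj_eq (addrI m)) subrKC.
  by case: eqP => [<-|_]; rewrite ?scaler0 // addrC addKr.
- by rewrite av_lie_c1 loop_coef0 loop_coef_c1 scaler0.
- by rewrite av_lie_c2 loop_coef0 loop_coef_c2 scaler0.
- rewrite av_lie_d_d loop_coefD !loop_coefZ.
  by rewrite !loop_coef_d loop_coef_c2 !scaler0 addr0.
by rewrite lieb_linearr !loop_coef_linear Hu Hv scalerDr !scalerA mulrC.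
Qed.

Lemma vir_coef_lie_d m u k :
  vir_coef [lie av_d g m, u] k = (k - m - m)%:~R * vir_coef u (k - m).
Proof.
elim/affVir_ind: u => [x n|||n|a u v Hu Hv].
- by rewrite av_lie_d_xt vir_coefZ !vir_coef_xt !mulr0.
- by rewrite av_lie_c1 vir_coef0 vir_coef_c1 mulr0.
- by rewrite av_lie_c2 vir_coef0 vir_coef_c2 mulr0.
- rewrite av_lie_d_d vir_coefD !vir_coefZ.
  rewrite !vir_coef_d vir_coef_c2 mulr0 addr0 -[_ == k - m](inj_eq (addrI m)) subrKC.
  by case: eqP => [<-|_]; rewrite ?scaler0 ?mulr0 // [m + n]addrC addrK.
rewrite lieb_linearr !vir_coef_linear Hu Hv mulrDr; congr (_ + _).
by rewrite -[LHS]/(a * _) mulrCA.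
Qed.

Lemma loop_coef_lie_xt x m u k :
  loop_coef [lie av_xt x m, u] k =
    [lie x, loop_coef u (k - m)] - (m%:~R * vir_coef u (k - m)) *: x.
Proof.
elim/affVir_ind: u => [y n|||n|a u v Hu Hv].
- rewrite av_lie_xt_xt loop_coefD loop_coefZ.
  rewrite loop_coef_c1 scaler0 add0r !loop_coef_xt vir_coef_xt mulr0 scale0r subr0.
  by rewrite linearMn /= -[_ == k - m](inj_eq (addrI m)) subrKC.
- by rewrite av_lie_c1 loop_coef0 loop_coef_c1 vir_coef_c1 lieb0r mulr0 scale0r subr0.
- by rewrite av_lie_c2 loop_coef0 loop_coef_c2 vir_coef_c2 lieb0r mulr0 scale0r subr0.
- rewrite liebC -scaleN1r loop_coefZ av_lie_d_xt.
  rewrite loop_coefZ loop_coef_xt loop_coef_d lieb0r sub0r vir_coef_d scaleN1r.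
  rewrite -[_ == k - m](inj_eq (addrI m)) subrKC [n + m]addrC.
  by case: eqP; rewrite ?mulr1 // mulr0 mulr0n scaler0 scale0r.
rewrite vir_coefD vir_coefZ lieb_linearr !loop_coef_linear Hu Hv lieb_linearr.
rewrite scalerBr mulrDr scalerDl opprD addrACA scalerA; congr (_ + (- (_ *: _) - _)).
by rewrite mulrCA.
Qed.

Lemma vir_coef_lie_xt x m u k : vir_coef [lie av_xt x m, u] k = 0.
Proof.
rewrite /vir_coef av_lieE av_vir_br.
have -> : av_vir (av_xt x m) = 0 by [].
by rewrite (bilin0l (vir_br_bilin K)) (linear_fun0 (lcoef_linear (V := K^o) k)).
Qed.

(** Elements without loop and Virasoro components are combinations of K_1 and K_2. *)
Lemma central_lie u w :
  loop_coef w =1 (fun=> 0) -> vir_coef w =1 (fun=> 0) -> [lie u, w] = 0.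
Proof.
move=> l0 r0.
have -> : w = av_K1 w *: av_c1 g + av_K2 w *: av_c2 g.
  apply: affVir_eq => [k|k||].
  - by rewrite loop_coefD !loop_coefZ loop_coef_c1 loop_coef_c2 !scaler0 addr0 l0.
  - by rewrite vir_coefD !vir_coefZ vir_coef_c1 vir_coef_c2 !mulr0 addr0 r0.
  - by rewrite -[RHS]/(_ * 1 + _ *: (0 : K^o)) scaler0 addr0 mulr1.
  - by rewrite -[RHS]/(_ *: (0 : K^o) + _ * 1) scaler0 add0r mulr1.
by rewrite liebDr !liebZr av_lie_c1 av_lie_c2 !scaler0 addr0.
Qed.

Lemma lie_d0_xt x n : [lie av_d g 0, av_xt x n] = n%:~R *: av_xt x n.
Proof. by rewrite av_lie_d_xt add0r. Qed.

Lemma lie_d0_d n : [lie av_d g 0, av_d g n] = n%:~R *: av_d g n.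
Proof.
by rewrite av_lie_d_d add0r subr0 expr0n subrr mul0r if_same scale0r addr0.
Qed.

End AffVirCoef.

(** * Derivations of the affine-Virasoro algebra *)

Section Diag.
Variables (K : fieldType) (V : lmodType K).

Definition ldiag (c : int -> K) : laurent V -> laurent V :=
  lext (fun i x => lmono i (c i *: x)).

Lemma lcoef_ldiag c f k : lcoef (ldiag c f) k = c k *: lcoef f k.
Proof.
have Fl i : linear (fun x : V => lmono i (c i *: x)).
  by move=> a x y; rewrite -lmono_linear scalerDr !scalerA mulrC.
elim/laurent_ind: f => [m x|f h Hf Hh].
  rewrite /ldiag lext_mono // !lcoef_mono.
  by case: eqP => [->|_]; rewrite ?scaler0.
rewrite /ldiag (linear_funD _ _ (lext_linear Fl)) !(linear_funD _ _ (lcoef_linear k)).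
by rewrite -!/(ldiag c _) Hf Hh scalerDr.
Qed.

End Diag.

(** [Der] for the adjoint module, stated on [L] itself so that the values of [D]
    can be bracketed. *)
Definition lie_der (K : fieldType) (L : lieAlgType K) (D : L -> L) :=
  linear D /\ forall x y, D [lie x, y] = [lie x, D y] - [lie y, D x].

Lemma lie_der_subr (K : fieldType) (L : lieAlgType K) (D : L -> L) v :
  lie_der D -> lie_der (fun u => D u - [lie u, v]).
Proof.
case=> Dl DD; split=> [a x y|x y].
  by rewrite Dl liebDl liebZl scalerBr opprD addrACA.
rewrite DD lieb_ad !liebBr !opprB [LHS]addrACA [RHS]addrACA; congr (_ + _).
exact: addrC.
Qed.

Section DerAffVir.
Variables (K : numFieldType) (g : finLieAlgType K).
Hypothesis g_centerless : forall z : g, (forall x, [lie x, z] = 0) -> z = 0.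
Hypothesis g_perfect : forall (W : lmodType K) (F : g -> W),
  linear F -> (forall x y, F [lie x, y] = 0) -> forall z, F z = 0.
Hypothesis g_killing : exists x y : g, killing x y != 0.
Hypothesis g_der : forall d : g -> g, linear d ->
  (forall x y, d [lie x, y] = [lie x, d y] - [lie y, d x]) ->
  exists z, forall x, d x = [lie x, z].
Local Notation L := (affVir g).
Implicit Types (u v w : L) (x y z : g) (m n k : int) (a b : K).

Lemma av_center w : (forall u, [lie u, w] = 0) ->
  loop_coef w =1 (fun=> 0) /\ vir_coef w =1 (fun=> 0).
Proof.
move=> wC.
have lw k : k != 0 -> loop_coef w k = 0.
  move=> k0; have := loop_coef_lie_d 0 w k; rewrite wC subr0 loop_coef0.
  by move/esym/eqP; rewrite scaler_eq0 intr_eq0 (negPf k0) => /eqP.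
have rw k : k != 0 -> vir_coef w k = 0.
  move=> k0; have := vir_coef_lie_d 0 w k; rewrite wC !subr0 vir_coef0.
  by move/esym/eqP; rewrite mulf_eq0 intr_eq0 (negPf k0) => /eqP.
split=> k; have [->|k0] := eqVneq k 0; [| exact: lw | | exact: rw].
  apply: g_centerless => x; have := loop_coef_lie_xt x 0 w 0.
  by rewrite wC subr0 loop_coef0 mul0r scale0r subr0.
have := vir_coef_lie_d 1 w 1; rewrite wC subrr vir_coef0.
by move/esym/eqP; rewrite mulf_eq0 intr_eq0 => /eqP.
Qed.

(** Such a derivation kills all brackets, and every generator is a combination of
    brackets: K_1 because the Killing form is nonzero, K_2 from [d_2, d_-2]. *)
Lemma der_central0 (D : L -> L) : lie_der D ->
  (forall u v, [lie u, D v] = 0) -> forall u, D u = 0.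
Proof.
move=> [Dl DD] DC; have D0 u v : D [lie u, v] = 0 by rewrite DD !DC subrr.
have Dx x m : D (av_xt x m) = 0.
  apply: (g_perfect (F := fun x => D (av_xt x m))) x => [a x y|x y].
    by rewrite av_xt_linear Dl.
  have := D0 (av_xt x 0) (av_xt y m).
  by rewrite av_lie_xt_xt mul0r if_same scale0r !add0r.
have Dd m : D (av_d g m) = 0.
  have [->|m0] := eqVneq m 0.
    have := D0 (av_d g (-1)) (av_d g 1); rewrite av_lie_d_d addNr.
    rewrite [X in X *: av_c2 g](_ : _ = 0); last exact: mul0r.
    rewrite scale0r addr0 (linear_funZ _ _ Dl).
    by apply: scaler_eq0r; rewrite intr_eq0.
  have := D0 (av_d g 0) (av_d g m); rewrite lie_d0_d (linear_funZ _ _ Dl).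
  by apply: scaler_eq0r; rewrite intr_eq0.
elim/affVir_ind => [x m|||m|a u v Du Dv] //.
- have [x [y kxy]] := g_killing.
  have := D0 (av_xt x 1) (av_xt y (-1)).
  rewrite av_lie_xt_xt subrr eqxx mul1r Dl Dx addr0.
  exact: scaler_eq0r.
- have := D0 (av_d g 2) (av_d g (-2)); rewrite av_lie_d_d subrr eqxx addrC Dl.
  rewrite (linear_funZ _ _ Dl) Dd scaler0 addr0; apply: scaler_eq0r.
  by apply: mulf_neq0; [rewrite intr_eq0 | rewrite invr_eq0 pnatr_eq0].
- by rewrite Dl Du Dv scaler0 addr0.
Qed.

(** If [u] has degree [n], applying [D] to [d_0, u] = n u gives
    (n - k) (D u)_k = - [u, D d_0]_k.  For k = n, where [D d_0] has degree 0, this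
    says that [D d_0] commutes with all x t^n, so that it is central; then the right
    side is zero for all [k]. *)
Lemma der_homogeneous (D : L -> L) : lie_der D ->
  (forall k, k != 0 -> loop_coef (D (av_d g 0)) k = 0 /\ vir_coef (D (av_d g 0)) k = 0) ->
  (forall u, [lie u, D (av_d g 0)] = 0) /\
  forall u n, [lie av_d g 0, u] = n%:~R *: u ->
  forall k, k != n -> loop_coef (D u) k = 0 /\ vir_coef (D u) k = 0.
Proof.
move=> [Dl DD] w0; set w := D _ in w0 *.
have key u n k : [lie av_d g 0, u] = n%:~R *: u ->
    (n - k)%:~R *: loop_coef (D u) k = - loop_coef [lie u, w] k /\
    (n - k)%:~R * vir_coef (D u) k = - vir_coef [lie u, w] k.
  move=> un; have := DD (av_d g 0) u; rewrite un (linear_funZ _ _ Dl) => E; split.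
    have := congr1 (fun u => loop_coef u k) E; rewrite loop_coefB loop_coefZ.
    rewrite loop_coef_lie_d subr0 => /eqP; rewrite eq_sym subr_eq addrC -subr_eq => /eqP <-.
    by rewrite intrB scalerBl opprB.
  have := congr1 (fun u => vir_coef u k) E; rewrite vir_coefB vir_coefZ.
  rewrite vir_coef_lie_d !subr0 => /eqP; rewrite eq_sym subr_eq addrC -subr_eq => /eqP <-.
  by rewrite intrB mulrBl opprB.
have wE : loop_coef w 0 = 0 /\ vir_coef w 0 = 0.
  have lw : loop_coef w 0 = 0.
    apply: g_centerless => x; have [+ _] := key (av_xt x 0) 0 0 (lie_d0_xt x 0).
    rewrite loop_coef_lie_xt subrr scale0r mul0r scale0r subr0.
    by move/esym/eqP; rewrite oppr_eq0 => /eqP.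
  split=> //; have [x [y xy]] := g_killing.
  have x0 : x != 0.
    apply: contraNneq xy => ->; have := killing_linearl y (-1) 0 0.
    by rewrite scaler0 addr0 mulN1r addNr => ->.
  have [+ _] := key (av_xt x 1) 1 1 (lie_d0_xt x 1).
  rewrite loop_coef_lie_xt subrr scale0r lw lieb0r mul1r sub0r opprK => /esym/eqP.
  by rewrite scaler_eq0 (negPf x0) orbF => /eqP.
have wC u : [lie u, w] = 0.
  apply: central_lie => k; have [->|k0] := eqVneq k 0;
    first [exact: wE.1 | exact: wE.2 | exact: (w0 k k0).1 | exact: (w0 k k0).2].
split=> // u n un k kn; have := key u n k un.
rewrite wC loop_coef0 vir_coef0 !oppr0.
case=> /eqP + /eqP; rewrite scaler_eq0 mulf_eq0 !intr_eq0 subr_eq0 eq_sym (negPf kn).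
by move=> /eqP -> /eqP.
Qed.

(** In the proof, [c], [psi] and [phi] are the coefficients of D(d_m) on d_m, of
    D(x t^m) on t^m and of D(d_m) on t^m. *)
Lemma der_affVir_graded (D : L -> L) : lie_der D ->
  (forall k, k != 0 -> loop_coef (D (av_d g 0)) k = 0 /\ vir_coef (D (av_d g 0)) k = 0) ->
  exists v, forall u, D u = [lie u, v].
Proof.
move=> Dd w0; have [wC Dhom] := der_homogeneous Dd w0.
have [Dl DD] := Dd.
have Dxh x m k := Dhom _ m (lie_d0_xt x m) k.
have Ddh m k := Dhom _ m (lie_d0_d g m) k.
have DC w : (forall u, [lie u, w] = 0) -> forall u, [lie u, D w] = 0.
  move=> wC' u; have := DD u w; rewrite wC' (linear_fun0 Dl) [X in _ - X]liebC.
  by rewrite wC' oppr0 subr0.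
(* the ideal spanned by the x t^m and K_1 is perfect modulo K_1 *)
have vx x m k : vir_coef (D (av_xt x m)) k = 0.
  apply: (g_perfect (W := K^o) (F := fun x => vir_coef (D (av_xt x m)) k)) x => [a x y|x y].
    by rewrite av_xt_linear Dl vir_coef_linear.
  have := DD (av_xt x 0) (av_xt y m).
  rewrite av_lie_xt_xt mul0r if_same scale0r !add0r => ->.
  by rewrite vir_coefB !vir_coef_lie_xt subrr.
pose c m := vir_coef (D (av_d g m)) m.
have cE m : c m = m%:~R * c 1.
  move: m; apply: offdiag_additive => m n.
  have [_ d20] := av_center (DC _ (av_lie_c2 (g := g))).
  have := congr1 (fun u => vir_coef u (m + n)) (DD (av_d g m) (av_d g n)).
  rewrite av_lie_d_d Dl (linear_funZ _ (av_c2 g) Dl) /=.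
  move: (D (av_c2 g)) d20 => w2 d20; rewrite vir_coefD 2!vir_coefZ d20 mulr0 addr0.
  rewrite vir_coefB !vir_coef_lie_d; have -> : m + n - m = n by ring.
  have -> : m + n - n = m by ring.
  by move=> ->; rewrite -[m - n]opprB intrN mulNr opprK mulrDr addrC.
pose psi m x := loop_coef (D (av_xt x m)) m.
pose phi m := loop_coef (D (av_d g m)) m.
have psiE m n x : n%:~R *: psi (m + n) x =
  n%:~R *: psi n x - ([lie x, phi m] - ((n * m)%:~R * c 1) *: x).
  have := congr1 (fun u => loop_coef u (m + n)) (DD (av_d g m) (av_xt x n)).
  rewrite av_lie_d_xt (linear_funZ _ _ Dl) /= loop_coefZ loop_coefB.
  rewrite loop_coef_lie_d loop_coef_lie_xt.
  have -> : m + n - m = n by ring.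
  have -> : m + n - n = m by ring.
  by rewrite -[vir_coef _ m]/(c m) [c m]cE mulrA -intrM.
(* at n = 0 only the bracket with phi_m survives *)
have phi0 m : phi m = 0.
  apply: g_centerless => x; have := psiE m 0 x.
  by rewrite !scale0r !mul0r scale0r subr0 sub0r => /esym/eqP; rewrite oppr_eq0 => /eqP.
have psi1 k x : psi k x = psi 1 x + ((k - 1)%:~R * c 1) *: x.
  have := psiE (k - 1) 1 x.
  by rewrite !scale1r subrK phi0 lieb0r sub0r opprK mul1r.
have psi0 k x : psi k x = psi 0 x + (k%:~R * c 1) *: x.
  rewrite psi1 [psi 0 x]psi1 -addrA -scalerDl -mulrDl -intrD; congr (_ + (_%:~R * _) *: _).
  by ring.
have [||z zE] := @g_der (psi 0).
- by move=> a x y; rewrite /psi av_xt_linear Dl loop_coef_linear.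
- move=> x y; have := congr1 (fun u => loop_coef u 0) (DD (av_xt x 0) (av_xt y 0)).
  rewrite av_lie_xt_xt [X in X *: av_c1 g](_ : _ = 0); last by rewrite mul0r.
  rewrite scale0r !add0r => /= E.
  by rewrite /psi E loop_coefB !loop_coef_lie_xt !mul0r !scale0r !subr0.
(* [lie x t^m, v] = psi_m(x) t^m and [lie d_m, v] = m c_1 d_m modulo the centre *)
pose v : L := av_xt z 0 - c 1 *: av_d g 0.
have lv k : loop_coef v k = z *+ (0 == k).
  by rewrite loop_coefB loop_coefZ loop_coef_xt loop_coef_d scaler0 subr0.
have rv k : vir_coef v k = - (c 1 * (0 == k)%:R).
  by rewrite vir_coefB vir_coefZ vir_coef_xt vir_coef_d sub0r.
exists v => u; apply/eqP; rewrite -subr_eq0; apply/eqP; move: u.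
have Ed := lie_der_subr v Dd.
apply: (der_central0 Ed) => u w; move: w u.
have ad0 k m : (0 == k - m) = (k == m) by rewrite eq_sym subr_eq0.
elim/affVir_ind => [x m|||m|a w1 w2 H1 H2] u.
- apply: central_lie => k.
    rewrite loop_coefB loop_coef_lie_xt lv rv ad0; have [->|km] := eqVneq k m.
      rewrite -[loop_coef _ m]/(psi m x) psi0 zE mulr1 mulrN scaleNr opprK mulr1n.
      exact: subrr.
    by rewrite (Dxh x m k km).1 mulr0n lieb0r mulr0 oppr0 mulr0 scale0r !subr0.
  by rewrite vir_coefB vx vir_coef_lie_xt subr0.
- rewrite liebBr DC ?[[lie av_c1 g, v]]liebC; last by move=> w; apply: av_lie_c1.
  by rewrite av_lie_c1 oppr0 lieb0r subr0.
- rewrite liebBr DC ?[[lie av_c2 g, v]]liebC; last by move=> w; apply: av_lie_c2.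
  by rewrite av_lie_c2 oppr0 lieb0r subr0.
- apply: central_lie => k.
    rewrite loop_coefB loop_coef_lie_d lv ad0; have [->|km] := eqVneq k m.
      by rewrite -[loop_coef _ m]/(phi m) phi0 subrr scale0r subr0.
    by rewrite (Ddh m k km).1 mulr0n scaler0 subr0.
  rewrite vir_coefB vir_coef_lie_d rv ad0; have [->|km] := eqVneq k m.
    by rewrite -[vir_coef _ m]/(c m) cE subrr sub0r mulr1 intrN mulrNN subrr.
  by rewrite (Ddh m k km).2 mulr0 oppr0 mulr0 subr0.
by rewrite Ed.1 lieb_linearr H1 H2 scaler0 addr0.
Qed.

(** Since [d_0, -] multiplies degree [k] by [k], dividing the components of [D d_0]
    by their degree gives an inner derivation with the same components of nonzero
    degree at d_0; the value 0^-1 = 0 takes care of degree 0. *)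
Lemma der_affVir_inner (D : L -> L) : lie_der D ->
  exists v, forall u, D u = [lie u, v].
Proof.
move=> Dd; pose w := D (av_d g 0).
pose v : L := (ldiag (fun k => k%:~R^-1) (av_loop w), 0, 0,
               ldiag (fun k => k%:~R^-1) (av_vir w)).
have [||v' v'E] := @der_affVir_graded (fun u => D u - [lie u, v]).
- exact: lie_der_subr.
- move=> k k0; have kN : k%:~R != 0 :> K by rewrite intr_eq0.
  rewrite loop_coefB vir_coefB.
  rewrite loop_coef_lie_d vir_coef_lie_d !subr0 [loop_coef v k]lcoef_ldiag.
  rewrite [vir_coef v k]lcoef_ldiag scalerA.
  by rewrite divff // scale1r mulrA divff // mul1r !subrr.
by exists (v' + v) => u; rewrite liebDr -v'E subrK.
Qed.

End DerAffVir.

Lemma simple_der_affVir (C : numClosedFieldType) (g : finLieAlgType C) :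
  lie_simple g -> forall D : affVir g -> affVir g, lie_der D ->
  exists v, forall u, D u = [lie u, v].
Proof.
move=> gS; apply: der_affVir_inner.
- exact: simple_centerless.
- exact: simple_perfect.
- exact: killing_neq0.
- exact: simple_der_inner.
Qed.

(** The Virasoro coefficient of [d_m, v] at degree k + m is (k - m) v_k; taking
    m = k + 1 shows v_k = 0. *)
Lemma gtilde_adjoint_inner (K : numFieldType) (g : finLieAlgType K) (v : affVir g) :
  (forall u, [lie u, v] \in @gtilde_pred _ g) ->
  exists w : gtilde g, forall u, gtilde_val (lact u w) = [lie u, v].
Proof.
move=> vg.
have rv k : vir_coef v k = 0.
  have /andP[_ /eqP] := vg (av_d g (k + 1))
    => /(congr1 (fun p : laurent K^o => lcoef p (k + (k + 1)))).
  rewrite -/(vir_coef _ _) vir_coef_lie_d addrK.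
  rewrite (linear_fun0 (lcoef_linear (V := K^o) _)) => /eqP.
  by rewrite mulf_eq0 intr_eq0 opprD addNKr => /eqP.
have wP : v - av_K2 v *: av_c2 g \in @gtilde_pred _ g.
  apply/andP; rewrite (linear_funB _ _ (@av_K2_linear _ g)).
  rewrite (linear_funZ _ _ (@av_K2_linear _ g)).
  rewrite (linear_funB _ _ (@av_vir_linear _ g)) (linear_funZ _ _ (@av_vir_linear _ g)).
  split; first by rewrite -[av_K2 (av_c2 g)]/(1 : K) [_ *: _]mulr1 subrr.
  apply/eqP/laurentP => k; rewrite -[av_vir (av_c2 g)]/0 scaler0 subr0.
  by rewrite -/(vir_coef v k) rv (linear_fun0 (lcoef_linear (V := K^o) k)).
exists (Gtilde wP) => u.
by rewrite -[LHS]/([lie u, v - av_K2 v *: av_c2 g]) liebBr liebZr av_lie_c2 scaler0 subr0.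
Qed.

Theorem theorem2p5 (R : realType) (g : finLieAlgType R[i])
    (hg : lie_simple g) :
  (forall c : H1 (affVir g) (gtilde g), c = 0) /\
  Der (affVir g) (adjoint (affVir g)) = Inn (affVir g) (adjoint (affVir g)).
Proof.
have inner := simple_der_affVir hg; split=> [c|].
  rewrite -[c]generic_quotient.reprK; apply/H1_pi_eq0.
  set D := generic_quotient.repr c; have [Dl DD] := derSpaceP D.
  have [v vE] : exists v, forall u, gtilde_val (D u) = [lie u, v].
    apply: inner; split=> [a x y|x y]; first by rewrite Dl.
    by rewrite DD.
  have vg u : [lie u, v] \in @gtilde_pred _ g by rewrite -vE; exact: valP (D u).
  have [w wE] := @gtilde_adjoint_inner _ _ v vg.
  by exists w => u; apply: val_inj; rewrite [RHS]wE -vE.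
apply/seteqP; split; last exact: Inn_sub_Der.
by move=> D DD; have [v vE] := inner D DD; exists v.
Qed.
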